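(* (1) The set of $F\in C(I)$ of bounded variation is $\Sigma^0_2$-complete. (2) The set of $F\in C(I)$ that are absolutely continuous is $\Pi^0_3$-complete.
   Context: $I=[0,1]$; $C(I)$ is the space of continuous real-valued functions on $I$ with the supremum norm. A point $F\in C(I)$ is given by a name, i.e. a function providing, for each rational $\varepsilon>0$, a piecewise linear function with rational breakpoints and values within $\varepsilon$ of $F$ in supremum norm. $\Sigma^0_n$ and $\Pi^0_n$ are the lightface (effective) classes: a subset of $\omega^\omega$ (resp. of $C(I)$) is $\Sigma^0_n$ if membership of $Z$ (resp. of the point named by $Z$) is expressed by a $\Sigma^0_n$ formula of arithmetic with parameter $Z$, and $\Pi^0_n$ sets are defined likewise. A set $A\subseteq C(I)$ is $\Gamma$-complete (for $\Gamma=\Sigma^0_2$ or $\Pi^0_3$) if it is in $\Gamma$ and for every $B\subseteq\omega^\omega$ in $\Gamma$ there is a computable function $f:\omega^\omega\to C(I)$ with $f^{-1}(A)=B$. *)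

(* Defs.v *)
From mathcomp Require Import all_boot all_order all_algebra.
From mathcomp Require Import all_classical all_reals all_analysis.

Set Implicit Arguments.
Unset Strict Implicit.
Unset Printing Implicit Defensive.

Import Order.TTheory GRing.Theory Num.Theory.
Import numFieldNormedType.Exports.

Local Open Scope classical_set_scope.
Local Open Scope ring_scope.

(** * Arithmetic with a function parameter *)

(* The language is 0, S, +, *, =, < together with a unary function symbol,
   written [TApp], for the parameter Z in the Baire space. *)
Inductive term :=
| TVar of nat
| TZero
| TSucc of term
| TAdd of term & term
| TMul of term & term
| TApp of term.

(* De Bruijn indices: each of the last four constructors binds variable 0 of its
   formula argument; the bound of a bounded quantifier lies outside the scope
   of that binder. *)
Inductive formula :=
| FEq of term & term
| FLt of term & term
| FNot of formula
| FAnd of formula & formula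
| FOr of formula & formula
| FBEx of term & formula
| FBAll of term & formula
| FEx of formula
| FAll of formula.

Fixpoint term_val (Z : nat -> nat) (e : seq nat) (t : term) : nat :=
  match t with
  | TVar i => nth 0%N e i
  | TZero => 0%N
  | TSucc t1 => (term_val Z e t1).+1
  | TAdd t1 t2 => (term_val Z e t1 + term_val Z e t2)%N
  | TMul t1 t2 => (term_val Z e t1 * term_val Z e t2)%N
  | TApp t1 => Z (term_val Z e t1)
  end.

Fixpoint sat (Z : nat -> nat) (e : seq nat) (phi : formula) : Prop :=
  match phi with
  | FEq t u => term_val Z e t = term_val Z e u
  | FLt t u => (term_val Z e t < term_val Z e u)%N
  | FNot p => ~ sat Z e p
  | FAnd p q => sat Z e p /\ sat Z e q
  | FOr p q => sat Z e p \/ sat Z e q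
  | FBEx t p => exists n, (n < term_val Z e t)%N /\ sat Z (n :: e) p
  | FBAll t p => forall n, (n < term_val Z e t)%N -> sat Z (n :: e) p
  | FEx p => exists n, sat Z (n :: e) p
  | FAll p => forall n, sat Z (n :: e) p
  end.

Fixpoint bounded_formula (phi : formula) : bool :=
  match phi with
  | FEq _ _ | FLt _ _ => true
  | FNot p | FBEx _ p | FBAll _ p => bounded_formula p
  | FAnd p q | FOr p q => bounded_formula p && bounded_formula q
  | FEx _ | FAll _ => false
  end.

(* n alternating blocks of like unbounded quantifiers in front of a bounded
   formula, the outermost block being existential for [Sigma0] and universal
   for [Pi0]. *)
Inductive Sigma0 : nat -> formula -> Prop :=
| Sigma0_bounded phi : bounded_formula phi -> Sigma0 0 phi
| Sigma0_Pi0 n phi : Pi0 n phi -> Sigma0 n.+1 phi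
| Sigma0_ex n phi : Sigma0 n.+1 phi -> Sigma0 n.+1 (FEx phi)
with Pi0 : nat -> formula -> Prop :=
| Pi0_bounded phi : bounded_formula phi -> Pi0 0 phi
| Pi0_Sigma0 n phi : Sigma0 n phi -> Pi0 n.+1 phi
| Pi0_all n phi : Pi0 n.+1 phi -> Pi0 n.+1 (FAll phi).

(** * Computability relative to an oracle *)

(* Kleene's schemes for partial recursive functionals of finitely many numbers
   and one oracle.  Arguments come in a list; missing arguments read as 0. *)
Inductive prog :=
| PZero
| PSucc
| PProj of nat
| POracle
| PComp of prog & seq prog
| PRec of prog & prog
| PMu of prog.

(* [computes X p v y]: with oracle X, program p halts on input v with output y.
   [PRec f g] is primitive recursion on the first argument, with g receiving
   the recursion index, the previous value and the parameters. In this clause,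
   h lists the successive values. [PMu f] searches for the least y with
   f(y, v) = 0, and needs f(m, v) to be defined for all m < y. *)
Fixpoint computes (X : nat -> nat) (p : prog) (v : seq nat) (y : nat) : Prop :=
  match p with
  | PZero => y = 0%N
  | PSucc => y = (head 0%N v).+1
  | PProj i => y = nth 0%N v i
  | POracle => y = X (head 0%N v)
  | PComp f gs =>
      exists ws : seq nat,
        (fix computes_all (gs : seq prog) (ws : seq nat) : Prop :=
           match gs, ws with
           | [::], [::] => True
           | g :: gs', w :: ws' => computes X g v w /\ computes_all gs' ws'
           | _, _ => False
           end) gs ws
        /\ computes X f ws y
  | PRec f g =>
      exists h : nat -> nat,
        [/\ computes X f (behead v) (h 0%N),
            forall i, (i < head 0%N v)%N ->
              computes X g (i :: h i :: behead v) (h i.+1)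
          & y = h (head 0%N v)]
  | PMu f =>
      computes X f (y :: v) 0%N /\
      forall m, (m < y)%N -> exists k, computes X f (m :: v) k.+1
  end.

(** * Coding of finite objects by natural numbers *)

(* Injective because b <= a + b, so the square part determines a + b. *)
Definition code_pair (a b : nat) : nat := ((a + b) ^ 2 + b)%N.

Definition code_int (z : int) : nat :=
  match z with Posz n => n.*2 | Negz n => n.*2.+1 end.

Definition code_rat (q : rat) : nat :=
  code_pair (code_int (numq q)) `|denq q|%N.

Definition code_vertices (s : seq (rat * rat)) : nat :=
  foldr (fun p c => (code_pair (code_pair (code_rat p.1) (code_rat p.2)) c).+1)
    0%N s.

(** * The space C(I) *)

(* The requirement that functions vanish off I makes this type exactly C(I). *)
Record CI (R : realType) := MkCI {
  CIfun :> R -> R ;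
  CI_continuous : {within `[0, 1], continuous CIfun} ;
  CI_restrict : CIfun \_ `[0, 1] = CIfun }.

Definition supnorm (R : realType) (G : R -> R) : R :=
  sup [set `|G x| | x in `[0, 1]].

(* A rational piecewise linear function on I is given by its nonempty list of
   vertices (abscissa, ordinate), with abscissas increasing from 0 to 1. *)
Definition pl_vertices (s : seq (rat * rat)) : Prop :=
  if s is p :: s' then p.1 = 0 /\ itv_partition 0 1 (unzip1 s') else False.

Fixpoint pl_from (R : realType) (p : rat * rat) (s : seq (rat * rat)) (x : R)
    : R :=
  match s with
  | [::] => ratr p.2
  | q :: s' =>
      if x <= ratr q.1
      then ratr p.2 + ratr ((q.2 - p.2) / (q.1 - p.1)) * (x - ratr p.1)
      else pl_from q s' x
  end.

Definition pl_fun (R : realType) (s : seq (rat * rat)) : R -> R :=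
  pl_from (head (0, 0) s) (behead s).

(* Values of Z at arguments that do not code a positive rational are
   irrelevant. *)
Definition is_name (R : realType) (Z : nat -> nat) (F : CI R) : Prop :=
  forall eps : rat, 0 < eps ->
    exists s, [/\ pl_vertices s, Z (code_rat eps) = code_vertices s
                & supnorm (F \- pl_fun s) <= ratr eps].

Definition computable_to_CI (R : realType) (f : (nat -> nat) -> CI R) : Prop :=
  exists p : prog, forall X : nat -> nat,
    exists2 Z : nat -> nat, is_name Z (f X) & forall n, computes X p [:: n] (Z n).

(** * Lightface classes and completeness *)

(* Below, [Gamma] is a class of formulas. Formulas are evaluated in the empty
   environment: a free variable denotes 0, so only the parameter matters. *)

Definition baire_class (Gamma : formula -> Prop) (B : set (nat -> nat)) : Prop :=
  exists2 phi, Gamma phi & forall Z, B Z <-> sat Z [::] phi.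

Definition CI_class (R : realType) (Gamma : formula -> Prop) (A : set (CI R))
    : Prop :=
  exists2 phi, Gamma phi &
    forall (F : CI R) Z, is_name Z F -> (A F <-> sat Z [::] phi).

Definition complete (R : realType) (Gamma : formula -> Prop) (A : set (CI R))
    : Prop :=
  CI_class Gamma A /\
  forall B, baire_class Gamma B ->
    exists2 f : (nat -> nat) -> CI R, computable_to_CI f & f @^-1` A = B.

(** * Absolute continuity *)

Definition absolutely_continuous (R : realType) (a b : R) (f : R -> R) : Prop :=
  forall eps : R, 0 < eps -> exists2 delta : R, 0 < delta &
    forall (n : nat) (l r : 'I_n -> R),
      (forall i, [/\ a <= l i, l i < r i & r i <= b]) ->
      trivIset setT (fun i => `]l i, r i[%classic) ->
      \sum_(i < n) (r i - l i) < delta ->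
      \sum_(i < n) `|f (r i) - f (l i)| < eps.

(* Main.v *)
Require Import Defs.
From mathcomp Require Import all_boot all_order all_algebra.
From mathcomp Require Import all_classical all_reals all_analysis.
From mathcomp Require Import zify ring lra.

Set Implicit Arguments.
Unset Strict Implicit.
Unset Printing Implicit Defensive.

Import Order.TTheory GRing.Theory Num.Theory.
Import numFieldNormedType.Exports.

Local Open Scope classical_set_scope.
Local Open Scope ring_scope.

(** Both upper bounds rest on one fact about a continuous function: its
    behaviour on the grids of mesh [1 / 4 ^ n] decides everything.  It has
    bounded variation iff the sums of the absolute increments over the cells of
    these grids are bounded by some [M] ([bounded_variation_grid]), and it is
    absolutely continuous iff for every [k] there is an [m] such that any set of
    cells of total length at most [1 / 2 ^ m] carries absolute increments of sum
    at most [1 / (k + 1)] ([absolutely_continuous_grid]).  A name yields these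
    sums up to an error of at most a constant, respectively a multiple of
    [1 / (k + 1)], that the outer quantifiers absorb ([name_sum_close]).  So the
    two properties take the shapes [exists M, forall n] and
    [forall k, exists m, forall n] in front of a relation decided by a program.

    To pass from programs to formulas, the graph of every program is shown to be
    existentially definable ([Sig1_computes], with Goedel's beta function for
    primitive recursion).  Since programs are single-valued, a program that
    always answers has a universally definable set of accepted inputs, and its
    quantifier merges with the innermost universal one.  Conversely, programs
    decide bounded formulas and like quantifiers contract through pairing, so
    every Sigma-2 or Pi-3 subset of the Baire space has a normal form with two or three
    quantifiers over a decidable relation ([Sigma0_2_normal_form],
    [Pi0_3_normal_form]).

    For hardness, [exists a, forall c, r a c] is first turned into the
    finiteness of a decidable set of events: a pointer runs through the
    candidates [a] and moves, which is an event, whenever a counterexample [c]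
    to the current candidate shows up ([finitely_many_events]).  Functions are
    then built from prescribed increments over the cells; if those at level [n]
    are at most of the order of [1 / 2 ^ n], the partial sums converge to a
    continuous function at an explicit rate, so its name is computable
    ([computable_from_increments]).

    For bounded variation, an event at level [n] adds to each cell a zigzag of
    height [1 / 2 ^ n].  The [4 ^ n] cells then produce variation at least
    [2 ^ n] at the next level, while levels without event produce none.  For
    absolute continuity, the function is the distribution function of a mixture
    with weights [1 / 2 ^ (k + 1)] of probability measures.  The [k]-th one
    halves its support at each event of the [k]-th candidate search, from level
    [k] on, and is spread evenly otherwise.  It has bounded density if there are finitely many
    events, and lives on sets of cells of arbitrarily small length if there are
    infinitely many, so the mixture is absolutely continuous iff every search
    has finitely many events ([mixture_criterion]). *)

(** * Substitution in formulas *)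

Section Substitution.
Local Open Scope nat_scope.
Implicit Types (Z : nat -> nat) (e : seq nat).

Fixpoint term_subst (s : nat -> term) (t : term) : term :=
  match t with
  | TVar i => s i
  | TZero => TZero
  | TSucc t1 => TSucc (term_subst s t1)
  | TAdd t1 t2 => TAdd (term_subst s t1) (term_subst s t2)
  | TMul t1 t2 => TMul (term_subst s t1) (term_subst s t2)
  | TApp t1 => TApp (term_subst s t1)
  end.

Definition term_shift : term -> term := term_subst (fun i => TVar i.+1).

Definition subst_up (s : nat -> term) (i : nat) : term :=
  if i is j.+1 then term_shift (s j) else TVar 0.

Fixpoint formula_subst (s : nat -> term) (phi : formula) : formula :=
  match phi with
  | FEq t u => FEq (term_subst s t) (term_subst s u)
  | FLt t u => FLt (term_subst s t) (term_subst s u)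
  | FNot p => FNot (formula_subst s p)
  | FAnd p q => FAnd (formula_subst s p) (formula_subst s q)
  | FOr p q => FOr (formula_subst s p) (formula_subst s q)
  | FBEx t p => FBEx (term_subst s t) (formula_subst (subst_up s) p)
  | FBAll t p => FBAll (term_subst s t) (formula_subst (subst_up s) p)
  | FEx p => FEx (formula_subst (subst_up s) p)
  | FAll p => FAll (formula_subst (subst_up s) p)
  end.

Lemma bounded_subst s phi :
  bounded_formula (formula_subst s phi) = bounded_formula phi.
Proof.
by elim: phi s => //= p IHp q IHq s; rewrite IHp IHq.
Qed.

Lemma term_val_subst Z e e' s t :
  (forall i, nth 0 e' i = term_val Z e (s i)) ->
  term_val Z e (term_subst s t) = term_val Z e' t.
Proof. by move=> ee'; elim: t => //= [t1 ->|t1 -> t2 ->|t1 -> t2 ->|t1 ->]. Qed.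

Lemma term_val_shift Z e n t : term_val Z (n :: e) (term_shift t) = term_val Z e t.
Proof. exact: term_val_subst. Qed.

Lemma subst_upP Z e e' s n :
  (forall i, nth 0 e' i = term_val Z e (s i)) ->
  forall i, nth 0 (n :: e') i = term_val Z (n :: e) (subst_up s i).
Proof. by move=> ee' [|i] //=; rewrite ee' term_val_shift. Qed.

(** The hypothesis compares environments through [nth] because the two lists
    may differ by trailing zeros, which no formula can see. *)
Lemma sat_subst Z e e' s phi :
  (forall i, nth 0 e' i = term_val Z e (s i)) ->
  sat Z e (formula_subst s phi) <-> sat Z e' phi.
Proof.
elim: phi e e' s => /= [t u|t u|p IHp|p IHp q IHq|p IHp q IHq|t p IHp|t p IHp
  |p IHp|p IHp] e e' s ee'.
- by rewrite !(term_val_subst _ ee').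
- by rewrite !(term_val_subst _ ee').
- by rewrite (IHp _ _ _ ee').
- by rewrite (IHp _ _ _ ee') (IHq _ _ _ ee').
- by rewrite (IHp _ _ _ ee') (IHq _ _ _ ee').
- rewrite (term_val_subst _ ee'); split=> -[n [nt pn]]; exists n; split=> //;
    exact/(IHp _ _ _ (subst_upP _ ee')).
- rewrite (term_val_subst _ ee'); split=> pn n /pn ?;
    exact/(IHp _ _ _ (subst_upP _ ee')).
- split=> -[n pn]; exists n; exact/(IHp _ _ _ (subst_upP _ ee')).
- split=> pn n; exact/(IHp _ _ _ (subst_upP _ ee')).
Qed.

End Substitution.

(** * Existentially definable relations *)

Section Sigma1.
Local Open Scope nat_scope.
Implicit Types (X : nat -> nat) (e : seq nat).
Implicit Types (P Q : (nat -> nat) -> seq nat -> Prop).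

(** The normal form with a single unbounded quantifier: a common bound for
    several witnesses serves as one witness. *)
Definition Sig1 P := exists2 phi, bounded_formula phi &
  forall X e, P X e <-> exists w, sat X (w :: e) phi.

Lemma Sig1_ext P Q : (forall X e, P X e <-> Q X e) -> Sig1 P -> Sig1 Q.
Proof. by move=> PQ [phi bphi phiP]; exists phi => // X e; rewrite -PQ phiP. Qed.

Lemma Sig1_subst P (E : (nat -> nat) -> seq nat -> seq nat) s :
  (forall X e i, nth 0 (E X e) i = term_val X e (s i)) ->
  Sig1 P -> Sig1 (fun X e => P X (E X e)).
Proof.
move=> sE [phi bphi phiP].
exists (formula_subst (subst_up s) phi); first by rewrite bounded_subst.
move=> X e; rewrite phiP; split=> -[w pw]; exists w;
  exact/(sat_subst _ (subst_upP _ (sE X e))).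
Qed.

Lemma Sig1_bounded phi : bounded_formula phi -> Sig1 (fun X e => sat X e phi).
Proof.
move=> bphi; exists (formula_subst (fun i => TVar i.+1) phi).
  by rewrite bounded_subst.
have sP X w e : sat X (w :: e) (formula_subst (fun i => TVar i.+1) phi) <->
  sat X e phi by apply: sat_subst.
by move=> X e; split=> [pe|[w /sP //]]; exists 0; apply/sP.
Qed.

Lemma Sig1_and P Q : Sig1 P -> Sig1 Q -> Sig1 (fun X e => P X e /\ Q X e).
Proof.
move=> [phi bphi phiP] [psi bpsi psiP].
(* variable 0 is the witness for the part, variable 1 the common bound *)
pose s i := if i is j.+1 then TVar j.+2 else TVar 0.
exists (FAnd (FBEx (TVar 0) (formula_subst s phi))
             (FBEx (TVar 0) (formula_subst s psi))).
  by rewrite /= !bounded_subst bphi.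
have sP X w b e chi : sat X (w :: b :: e) (formula_subst s chi) <->
  sat X (w :: e) chi by apply: sat_subst => -[].
move=> X e; rewrite phiP psiP; split=> /=.
  move=> [[w pw] [v qv]]; exists (w + v).+1; split.
    by exists w; split; [lia | exact/sP].
  by exists v; split; [lia | exact/sP].
by move=> [b [[w [_ /sP pw]] [v [_ /sP qv]]]]; split; [exists w | exists v].
Qed.

Lemma Sig1_ex P : Sig1 P -> Sig1 (fun X e => exists n, P X (n :: e)).
Proof.
move=> [phi bphi phiP].
pose s i := match i with 0 => TVar 0 | 1 => TVar 1 | j.+2 => TVar j.+3 end.
exists (FBEx (TVar 0) (FBEx (TVar 1) (formula_subst s phi))).
  by rewrite /= bounded_subst.
have sP X w n b e : sat X (w :: n :: b :: e) (formula_subst s phi) <->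
  sat X (w :: n :: e) phi by apply: sat_subst => -[|[]].
move=> X e; split=> [[n /phiP[w pw]]|[b /= [n [_ [w [_ /sP pw]]]]]]; last first.
  by exists n; apply/phiP; exists w.
exists (n + w).+1; exists n; split=> /=; first by lia.
by exists w; split; [lia | exact/sP].
Qed.

(** Collection: finitely many witnesses have a common bound. *)
Lemma Sig1_ball t P : Sig1 P ->
  Sig1 (fun X e => forall n, n < term_val X e t -> P X (n :: e)).
Proof.
move=> [phi bphi phiP].
pose s i := match i with 0 => TVar 0 | 1 => TVar 1 | j.+2 => TVar j.+3 end.
exists (FBAll (term_shift t) (FBEx (TVar 1) (formula_subst s phi))).
  by rewrite /= bounded_subst.
have sP X w n b e : sat X (w :: n :: b :: e) (formula_subst s phi) <->
  sat X (w :: n :: e) phi by apply: sat_subst => -[|[]].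
move=> X e; split=> [Pn|[b] /= + n nt]; last first.
  by rewrite term_val_shift => /(_ _ nt)[w [_ /sP pw]]; apply/phiP; exists w.
have {Pn}: forall n, exists w, n < term_val X e t -> sat X (w :: n :: e) phi.
  move=> n; case: (ltnP n (term_val X e t)) => [/Pn/phiP[w pw]|_].
    by exists w.
  by exists 0.
move=> /choice[f fP]; exists (\max_(i < term_val X e t) f i).+1 => /= n.
rewrite term_val_shift => nt; exists (f n); split; last exact/sP/fP.
by rewrite ltnS (leq_bigmax (Ordinal nt)).
Qed.

End Sigma1.

(** * Goedel's beta function *)

Section Beta.
Local Open Scope nat_scope.

(** The remainders of [a] modulo the pairwise coprime numbers
    [1 + (i + 1) * b] can be prescribed, by the Chinese remainder theorem; a
    pair of numbers thus codes a finite sequence. *)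
Definition beta (a b i : nat) : nat := a %% (i.+1 * b).+1.

Lemma betaP a b i u :
  beta a b i = u <-> exists q, q < a.+1 /\
    (a = q * (i.+1 * b).+1 + u /\ u < (i.+1 * b).+1).
Proof.
split=> [<-|[q [_ [-> ub]]]].
  exists (a %/ (i.+1 * b).+1); split; first by rewrite ltnS leq_div.
  by split; [exact: divn_eq | rewrite ltn_mod].
by rewrite /beta modnMDl modn_small.
Qed.

Lemma beta_moduli_coprime n i j : i < j <= n ->
  coprime (i.+1 * n`!).+1 (j.+1 * n`!).+1.
Proof.
move=> /andP[ij jn]; apply/eqP; set d := gcdn _ _.
have d0 : 0 < d by rewrite gcdn_gt0.
case: (leqP d 1) => [|d1]; first by lia.
(* a prime dividing both moduli divides (j - i) n!, hence n! *)
have [p pr pd] := pdivP d1.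
have pi : p %| (i.+1 * n`!).+1 by rewrite (dvdn_trans pd) ?dvdn_gcdl.
have pj : p %| (j.+1 * n`!).+1 by rewrite (dvdn_trans pd) ?dvdn_gcdr.
have : p %| (j - i) * n`!.
  have -> : (j - i) * n`! = (j.+1 * n`!).+1 - (i.+1 * n`!).+1 by nia.
  exact: dvdn_sub.
have pn : p %| (j - i) * n`! -> p %| n`!.
  rewrite Euclid_dvdM // => /orP[pji|//]; apply: dvdn_trans pji _.
  by apply: dvdn_fact; lia.
move=> {}/pn pn.
move: pi; rewrite -addn1 dvdn_addr; last exact: dvdn_mull.
by rewrite dvdn1 => /eqP p1; rewrite p1 in pr.
Qed.

Lemma beta_exists (h : nat -> nat) n :
  exists a b, forall i, i < n -> beta a b i = h i.
Proof.
pose N := n + \max_(i < n) h i.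
suff [a aP] : exists a, forall i, i < n -> a = h i %[mod (i.+1 * N`!).+1].
  exists a, N`! => i ni; rewrite /beta aP // modn_small // ltnS.
  have hN : h i <= N.
    apply: leq_trans (leq_addl _ _).
    exact: (leq_bigmax (F := fun i : 'I_n => h i) (Ordinal ni)).
  have NN : N <= N`! by case: (N) => // m; rewrite dvdn_leq ?fact_gt0 ?dvdn_fact ?leqnn.
  by rewrite (leq_trans hN) // (leq_trans NN) // leq_pmull.
suff: forall m, m <= N ->
    exists a, forall i, i < m -> a = h i %[mod (i.+1 * N`!).+1].
  by apply; rewrite leq_addr.
elim=> [|m IHm] mN; first by exists 0.
have [a aP] := IHm (ltnW mN).
pose M := \prod_(i < m) (i.+1 * N`!).+1.
have cM : coprime M (m.+1 * N`!).+1.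
  rewrite /M; elim/big_ind: _ => //; first by rewrite coprime1n.
    by move=> x y; rewrite coprimeMl => -> ->.
  by move=> i _; apply: beta_moduli_coprime; rewrite ltn_ord ltnW.
exists (chinese M (m.+1 * N`!).+1 a (h m)) => i.
rewrite ltnS leq_eqVlt => /orP[/eqP ->|im]; first exact: chinese_modr.
have dM : (i.+1 * N`!).+1 %| M.
  by rewrite /M (bigD1 (Ordinal im)) //= dvdn_mulr.
by rewrite -aP // -(modn_dvdm _ dM) chinese_modl // modn_dvdm.
Qed.

End Beta.
(** * Graphs of programs are existentially definable *)

Section Programs.
Local Open Scope nat_scope.
Implicit Types (X : nat -> nat) (p f g : prog) (gs : seq prog) (v ws : seq nat).

Definition computes_all X v : seq prog -> seq nat -> Prop :=
  fix computes_all gs ws :=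
    match gs, ws with
    | [::], [::] => True
    | g :: gs', w :: ws' => computes X g v w /\ computes_all gs' ws'
    | _, _ => False
    end.

Lemma computes_comp X f gs v y : computes X (PComp f gs) v y =
  exists ws, computes_all X v gs ws /\ computes X f ws y.
Proof. by []. Qed.

Fixpoint all_progs (P : prog -> Prop) gs : Prop :=
  if gs is g :: gs' then P g /\ all_progs P gs' else True.

(** The induction principle generated for [prog] gives no hypothesis on the
    list of inner programs of a composition. *)
Lemma prog_nested_ind (P : prog -> Prop) :
  P PZero -> P PSucc -> (forall i, P (PProj i)) -> P POracle ->
  (forall f gs, P f -> all_progs P gs -> P (PComp f gs)) ->
  (forall f g, P f -> P g -> P (PRec f g)) ->
  (forall f, P f -> P (PMu f)) ->
  forall p, P p.
Proof.
move=> P0 PS PP PO PC PR PM; fix IH 1; case=> [||i||f gs|f g|f].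
- exact: P0.
- exact: PS.
- exact: PP.
- exact: PO.
- apply: PC; first exact: IH.
  by elim: gs => //=.
- by apply: PR; exact: IH.
- by apply: PM; exact: IH.
Qed.

(** Single-valuedness lets a decider refute: the formula for one answer
    excludes the other. *)
Lemma computes_functional X p v y y' :
  computes X p v y -> computes X p v y' -> y = y'.
Proof.
elim/prog_nested_ind: p v y y' => /= [||i||f gs IHf IHgs|f g IHf IHg|f IHf]
    v y y'.
- by move=> -> ->.
- by move=> -> ->.
- by move=> -> ->.
- by move=> -> ->.
- move=> [ws [gws fy]] [ws' [gws' fy']].
  suff ww : ws = ws' by rewrite ww in fy; exact: IHf fy fy'.
  elim: gs IHgs ws ws' gws gws' {fy fy'} => [_ [|? ?] [|? ?] //|].
  move=> g gs IH /= [IHg {}/IH IHgs] [//|w ws] [//|w' ws'].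
  by move=> [/IHg gw {}/IHgs IH] [/gw -> /IH ->].
- move=> [h [h0 hS ->]] [h' [h'0 h'S ->]].
  elim: (head 0 v) hS h'S => [_ _|n IHn hS h'S]; first exact: IHf h0 h'0.
  have hn : h n = h' n by apply: IHn => i ni; [apply: hS | apply: h'S]; lia.
  have := h'S n (ltnSn n); rewrite -hn; apply: IHg; exact: hS.
- move=> [fy ymin] [fy' y'min]; case: (ltngtP y y') => // [/y'min|/ymin] [k fk].
    by have := IHf _ _ _ fy fk.
  by have := IHf _ _ _ fy' fk.
Qed.

Definition Sig1_prog p := Sig1 (fun X e => computes X p (behead e) (nth 0 e 0)).

Lemma Sig1_call p (args : (nat -> nat) -> seq nat -> seq nat) out s :
  Sig1_prog p ->
  (forall X e i, nth 0 (out X e :: args X e) i = term_val X e (s i)) ->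
  Sig1 (fun X e => computes X p (args X e) (out X e)).
Proof. by move=> pP sP; exact: (Sig1_subst sP pP). Qed.

(** The values of the inner programs are quantified one at a time: the
    environment is [w_k; ...; w_1; y; v] after [k] of them. *)
Lemma Sig1_prog_comp f gs :
  Sig1_prog f -> all_progs Sig1_prog gs -> Sig1_prog (PComp f gs).
Proof.
move=> fP gsP; pose args k e := [seq nth 0 e (k - i.+1) | i <- iota 0 k].
suff main k : Sig1 (fun X e => exists ws,
    computes_all X (drop k.+1 e) gs ws /\
    computes X f (args k e ++ ws) (nth 0 e k)).
  apply: Sig1_ext (main 0) => X e; rewrite computes_comp drop1.
  by split=> -[ws [gws fws]]; exists ws; split=> //; rewrite nth0 in fws *.
elim: gs gsP k => [_|g gs IH [gP {}/IH gsP]] k.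
  apply: (@Sig1_ext (fun X e => computes X f (args k e) (nth 0 e k))).
    move=> X e; split=> [fe|[[|w ws] [] //= _]]; last by rewrite cats0.
    by exists [::]; rewrite cats0.
  apply: (@Sig1_call _ _ _ (fun i => if i is j.+1 then
    if j < k then TVar (k - j.+1) else TZero else TVar k)) => // X e [|i] //=.
  case: ltnP => ik.
    by rewrite (nth_map 0) ?size_iota// nth_iota// add0n.
  by rewrite nth_default// size_map size_iota.
apply: (@Sig1_ext (fun X e => exists w, computes X g (drop k.+1 e) w /\
    exists ws, computes_all X (drop k.+1 e) gs ws /\
    computes X f (args k e ++ w :: ws) (nth 0 e k))).
  move=> X e; split.
    by move=> [w [gw [ws [gws fws]]]]; exists (w :: ws).
  by move=> [[|w ws] [] //= [gw gws] fws]; exists w; split=> //; exists ws.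
apply: (@Sig1_ext (fun X e => exists w, computes X g (drop k.+2 (w :: e)) w /\
    exists ws, computes_all X (drop k.+2 (w :: e)) gs ws /\
    computes X f (args k.+1 (w :: e) ++ ws) (nth 0 (w :: e) k.+1))).
  move=> X e; have aS w ws : args k.+1 (w :: e) ++ ws = args k e ++ w :: ws.
    have -> : args k.+1 (w :: e) = rcons (args k e) w.
      have -> : args k.+1 (w :: e) =
          [seq nth 0 (w :: e) (k.+1 - i.+1) | i <- rcons (iota 0 k) k].
        by congr map; rewrite -addn1 iotaD cats1.
      rewrite map_rcons subnn; congr rcons; apply/eq_in_map => i.
      by rewrite mem_iota => /andP[_ ik]; rewrite subSn.
    by rewrite cat_rcons.
  by split=> -[w [gw [ws [gws fws]]]]; exists w; split=> //; exists ws; split=> //;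
    [rewrite -aS | rewrite aS].
apply: (@Sig1_ex (fun X e => computes X g (drop k.+2 e) (nth 0 e 0) /\
    exists ws, computes_all X (drop k.+2 e) gs ws /\
    computes X f (args k.+1 e ++ ws) (nth 0 e k.+1))).
apply: Sig1_and => //.
apply: (@Sig1_call _ _ _ (fun i => TVar (if i is j.+1 then k.+2 + j else 0))) => //.
by move=> X e [|i] //=; rewrite nth_drop.
Qed.

Definition FBeta (a b i u : nat) : formula :=
  FBEx (TSucc (TVar a)) (FAnd
    (FEq (TVar a.+1) (TAdd (TMul (TVar 0)
      (TSucc (TMul (TSucc (TVar i.+1)) (TVar b.+1)))) (TVar u.+1)))
    (FLt (TVar u.+1) (TSucc (TMul (TSucc (TVar i.+1)) (TVar b.+1))))).

Lemma Sig1_beta a b i u :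
  Sig1 (fun X e => beta (nth 0 e a) (nth 0 e b) (nth 0 e i) = nth 0 e u).
Proof.
apply: (@Sig1_ext (fun X e => sat X e (FBeta a b i u))).
  by move=> X e; rewrite betaP.
exact: Sig1_bounded.
Qed.

(** The sequence of intermediate values becomes two numbers [a] and [b] that
    code it through [beta]. *)
Lemma Sig1_prog_rec f g : Sig1_prog f -> Sig1_prog g -> Sig1_prog (PRec f g).
Proof.
move=> fP gP.
apply: (@Sig1_ext (fun X e => exists a, exists b,
  (exists u, beta a b 0 = u /\ computes X f (drop 2 e) u) /\
  (beta a b (nth 0 e 1) = nth 0 e 0 /\
   forall i, i < nth 0 e 1 -> exists u, exists w, beta a b i = u /\
     (beta a b i.+1 = w /\
      computes X g (i :: u :: drop 2 e) w)))).
  move=> X e; have -> : nth 0 e 1 = head 0 (behead e) by case: e => [|? []].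
  have -> : drop 2 e = behead (behead e) by case: e => [|? [|? ?]] //=; rewrite drop0.
  rewrite /=; split; last first.
    move=> [h [h0 hS ->]].
    have [a [b abh]] := beta_exists h (head 0 (behead e)).+1; exists a, b.
    split; first by exists (h 0); rewrite abh.
    split; first by rewrite abh.
    move=> i iv; exists (h i), (h i.+1); rewrite !abh //; last by lia.
    by do 2!split=> //; exact: hS.
  move=> [a [b [[u [<- fu]] [<- H]]]].
  by exists (beta a b); split=> // i /H [_ [_ [<- [<-]]]].
(* environments: [b; a; y; n; v], then [u; b; a; ...] or [w; u; i; b; a; ...] *)
apply: (@Sig1_ex (fun X e => exists b,
  (exists u, beta (nth 0 e 0) b 0 = u /\ computes X f (drop 3 e) u) /\
  (beta (nth 0 e 0) b (nth 0 e 2) = nth 0 e 1 /\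
   forall i, i < nth 0 e 2 -> exists u, exists w,
     beta (nth 0 e 0) b i = u /\
     (beta (nth 0 e 0) b i.+1 = w /\
      computes X g (i :: u :: drop 3 e) w)))).
apply: (@Sig1_ex (fun X e => 
  (exists u, beta (nth 0 e 1) (nth 0 e 0) 0 = u /\ computes X f (drop 4 e) u) /\
  (beta (nth 0 e 1) (nth 0 e 0) (nth 0 e 3) = nth 0 e 2 /\
   forall i, i < term_val X e (TVar 3) -> exists u, exists w,
     beta (nth 0 e 1) (nth 0 e 0) i = u /\
     (beta (nth 0 e 1) (nth 0 e 0) i.+1 = w /\
      computes X g (i :: u :: drop 4 e) w)))).
apply: Sig1_and.
  apply: (@Sig1_ex (fun X e => beta (nth 0 e 2) (nth 0 e 1) 0 = nth 0 e 0 /\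
    computes X f (drop 5 e) (nth 0 e 0))).
  apply: Sig1_and.
    pose s i := match i with 0 => TVar 2 | 1 => TVar 1 | 2 => TZero
      | 3 => TVar 0 | _ => TZero end.
    apply: (@Sig1_subst _ (fun X e => [:: nth 0 e 2; nth 0 e 1; 0; nth 0 e 0]) s _
      (Sig1_beta 0 1 2 3)).
    by move=> X e [|[|[|[|i]]]] //=; rewrite nth_default.
  apply: (@Sig1_call _ _ _ (fun i => TVar (if i is j.+1 then 5 + j else 0))) => //.
  by move=> X e [|i] //=; rewrite nth_drop.
apply: Sig1_and; first exact: Sig1_beta.
apply: (@Sig1_ball _ (fun X e => exists u, exists w,
     beta (nth 0 e 2) (nth 0 e 1) (nth 0 e 0) = u /\
     (beta (nth 0 e 2) (nth 0 e 1) (nth 0 e 0).+1 = w /\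
      computes X g (nth 0 e 0 :: u :: drop 5 e) w))).
apply: (@Sig1_ex (fun X e => exists w,
     beta (nth 0 e 3) (nth 0 e 2) (nth 0 e 1) = nth 0 e 0 /\
     (beta (nth 0 e 3) (nth 0 e 2) (nth 0 e 1).+1 = w /\
      computes X g (nth 0 e 1 :: nth 0 e 0 :: drop 6 e) w))).
apply: (@Sig1_ex (fun X e =>
     beta (nth 0 e 4) (nth 0 e 3) (nth 0 e 2) = nth 0 e 1 /\
     (beta (nth 0 e 4) (nth 0 e 3) (nth 0 e 2).+1 = nth 0 e 0 /\
      computes X g (nth 0 e 2 :: nth 0 e 1 :: drop 7 e) (nth 0 e 0)))).
apply: Sig1_and; first exact: Sig1_beta.
apply: Sig1_and.
  pose s i := match i with 0 => TVar 4 | 1 => TVar 3 | 2 => TSucc (TVar 2)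
    | 3 => TVar 0 | _ => TZero end.
  apply: (@Sig1_subst _
    (fun X e => [:: nth 0 e 4; nth 0 e 3; (nth 0 e 2).+1; nth 0 e 0]) s _
    (Sig1_beta 0 1 2 3)).
  by move=> X e [|[|[|[|i]]]] //=; rewrite nth_default.
apply: (@Sig1_call _ _ _ (fun i => TVar (match i with 0 => 0 | 1 => 2 | 2 => 1
  | j.+3 => 7 + j end))) => //.
by move=> X e [|[|[|i]]] //=; rewrite nth_drop.
Qed.

Lemma Sig1_prog_mu f : Sig1_prog f -> Sig1_prog (PMu f).
Proof.
move=> fP; apply: (@Sig1_ext (fun X e =>
  computes X f (nth 0 e 0 :: behead e) 0 /\
  forall m, m < term_val X e (TVar 0) -> exists k,
    computes X f (m :: drop 1 e) k.+1)); first by move=> X e; rewrite drop1.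
apply: Sig1_and.
  apply: (@Sig1_call _ _ _ (fun i => match i with 0 => TZero | j.+1 => TVar j end))
    => // X [|y e] [|[|i]] //=; by rewrite nth_default.
apply: (@Sig1_ball _ (fun X e => exists k,
    computes X f (nth 0 e 0 :: drop 2 e) k.+1)).
apply: (@Sig1_ex (fun X e =>
    computes X f (nth 0 e 1 :: drop 3 e) (nth 0 e 0).+1)).
apply: (@Sig1_call _ _ _ (fun i => match i with 0 => TSucc (TVar 0) | 1 => TVar 1
  | j.+2 => TVar (3 + j) end)) => //.
by move=> X e [|[|i]] //=; rewrite nth_drop.
Qed.

Theorem Sig1_computes p : Sig1_prog p.
Proof.
elim/prog_nested_ind: p => [||i||||].
- apply: (@Sig1_ext (fun X e => sat X e (FEq (TVar 0) TZero))) => //.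
  exact: Sig1_bounded.
- apply: (@Sig1_ext (fun X e => sat X e (FEq (TVar 0) (TSucc (TVar 1))))).
    by move=> X [|y [|x v]].
  exact: Sig1_bounded.
- apply: (@Sig1_ext (fun X e => sat X e (FEq (TVar 0) (TVar i.+1)))).
    by move=> X e /=; rewrite nth_behead.
  exact: Sig1_bounded.
- apply: (@Sig1_ext (fun X e => sat X e (FEq (TVar 0) (TApp (TVar 1))))).
    by move=> X [|y [|x v]].
  exact: Sig1_bounded.
- exact: Sig1_prog_comp.
- exact: Sig1_prog_rec.
- exact: Sig1_prog_mu.
Qed.

End Programs.
(** * Unpairing *)

Section Pairing.
Local Open Scope nat_scope.

(** The integer square root, which recovers [a + b] from [code_pair a b]. *)
Definition root_nat (n : nat) : nat := \sum_(s < n) (s.+1 ^ 2 <= n).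

Lemma root_natP n : root_nat n ^ 2 <= n < (root_nat n).+1 ^ 2.
Proof.
have main k : (forall s, s < k -> s.+1 ^ 2 <= n) -> n < k.+1 ^ 2 ->
    root_nat n = k.
  move=> kn nk; rewrite /root_nat.
  have kn' : k <= n.
    by case: k kn {nk} => // k /(_ k (ltnSn k)) /(leq_trans _); apply; nia.
  rewrite -(big_mkord xpredT (fun s => (s.+1 ^ 2 <= n) : nat)).
  rewrite (big_cat_nat (n := k)) //= [X in X + _](_ : _ = k); last first.
    rewrite big_mkord (eq_bigr (fun=> 1)) ?sum1_card ?card_ord// => i _.
    by rewrite kn.
  rewrite big_nat big1 ?addn0 // => i /andP[ki _].
  by rewrite leqNgt (leq_trans nk) // leq_exp2r.
have : exists k, n < k.+1 ^ 2 by exists n; nia.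
move=> ex; have := ex_minnP ex; case=> k nk kmin.
have kn s : s < k -> s.+1 ^ 2 <= n.
  by move=> sk; rewrite leqNgt; apply/negP => /kmin; rewrite leqNgt sk.
rewrite (main k) // nk andbT; case: k kn {nk kmin} => // k; exact.
Qed.

Lemma root_nat_unique n s : s ^ 2 <= n < s.+1 ^ 2 -> root_nat n = s.
Proof. by have := root_natP n => /andP[? ?] /andP[? ?]; nia. Qed.

Definition unpair2 (n : nat) : nat := n - root_nat n ^ 2.
Definition unpair1 (n : nat) : nat := root_nat n - unpair2 n.

Lemma root_code_pair a b : root_nat (code_pair a b) = a + b.
Proof. by apply: root_nat_unique; rewrite /code_pair; nia. Qed.

Lemma code_pairK2 a b : unpair2 (code_pair a b) = b.
Proof. by rewrite /unpair2 root_code_pair /code_pair addKn. Qed.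

Lemma code_pairK1 a b : unpair1 (code_pair a b) = a.
Proof. by rewrite /unpair1 code_pairK2 root_code_pair addnK. Qed.

End Pairing.

(** * Effective maps between coded types *)

Class coded (T : Type) := encode : T -> nat.

#[export] Instance coded_nat : coded nat := fun n => n.
#[export] Instance coded_bool : coded bool := nat_of_bool.
#[export] Instance coded_int : coded int := code_int.
#[export] Instance coded_rat : coded rat := code_rat.
#[export] Instance coded_pair A B (cA : coded A) (cB : coded B) : coded (A * B) :=
  fun t => code_pair (encode t.1) (encode t.2).
#[export] Instance coded_seq A (cA : coded A) : coded (seq A) :=
  foldr (fun x c => (code_pair (encode x) c).+1) 0%N.

(** One program must serve all oracles in [D], and only those: a map may be
    effective on the set of names without being so elsewhere. *)
Definition effective (D : set (nat -> nat)) A B (cA : coded A) (cB : coded B)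
    (f : (nat -> nat) -> A -> B) :=
  exists p, forall X, D X -> forall a, computes X p [:: encode a] (encode (f X a)).
Arguments effective D {A B cA cB} f.

Local Arguments computes : simpl never.

Section RawPrograms.
Local Open Scope nat_scope.
Implicit Types (X : nat -> nat) (p f g : prog).

Lemma computes_comp1 X f g v x z :
  computes X g v x -> computes X f [:: x] z -> computes X (PComp f [:: g]) v z.
Proof. by move=> gx fz; exists [:: x]. Qed.

Lemma computes_comp2 X f g1 g2 v x1 x2 z :
  computes X g1 v x1 -> computes X g2 v x2 -> computes X f [:: x1; x2] z ->
  computes X (PComp f [:: g1; g2]) v z.
Proof. by move=> gx1 gx2 fz; exists [:: x1; x2]. Qed.

Lemma computes_comp3 X f g1 g2 g3 v x1 x2 x3 z :
  computes X g1 v x1 -> computes X g2 v x2 -> computes X g3 v x3 ->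
  computes X f [:: x1; x2; x3] z ->
  computes X (PComp f [:: g1; g2; g3]) v z.
Proof. by move=> gx1 gx2 gx3 fz; exists [:: x1; x2; x3]. Qed.

Lemma computes_rec X f g n v (h : nat -> nat) :
  computes X f v (h 0) ->
  (forall i, i < n -> computes X g (i :: h i :: v) (h i.+1)) ->
  computes X (PRec f g) (n :: v) (h n).
Proof. by move=> fh gh; exists h. Qed.

Definition raw_op2 (op : nat -> nat -> nat) :=
  exists p, forall X x y, computes X p [:: x; y] (op x y).

Lemma raw_addn : raw_op2 addn.
Proof.
exists (PRec (PProj 0) (PComp PSucc [:: PProj 1])) => X x y.
by apply: (computes_rec (h := addn^~ y)) => // i _; apply: computes_comp1.
Qed.

Lemma raw_muln : raw_op2 muln.
Proof.
have [p pP] := raw_addn.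
exists (PRec PZero (PComp p [:: PProj 2; PProj 1])) => X x y.
apply: (computes_rec (h := muln^~ y)) => // i _.
by apply: computes_comp2; last by rewrite mulSn; exact: pP.
Qed.

Lemma raw_subn : raw_op2 subn.
Proof.
pose pr := PRec PZero (PProj 0).
have prP X x : computes X pr [:: x] x.-1.
  exact: (computes_rec (h := predn)).
exists (PComp (PRec (PProj 0) (PComp pr [:: PProj 1])) [:: PProj 1; PProj 0]).
move=> X x y; apply: computes_comp2 => //.
apply: (computes_rec (h := subn x)) => [|i _] /=; first by rewrite subn0.
by apply: computes_comp1 => //; rewrite subnS; exact: prP.
Qed.

Lemma raw_code_pair : raw_op2 code_pair.
Proof.
have [pa paP] := raw_addn; have [pm pmP] := raw_muln.
pose s := PComp pa [:: PProj 0; PProj 1].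
have sP X x y : computes X s [:: x; y] (x + y) by apply: computes_comp2; last exact: paP.
exists (PComp pa [:: PComp pm [:: s; s]; PProj 1]) => X x y.
by apply: computes_comp2; [apply: computes_comp2; last exact: pmP | | exact: paP].
Qed.

Lemma raw_root : exists p, forall X n, computes X p [:: n] (root_nat n).
Proof.
have [pm pmP] := raw_muln; have [ps psP] := raw_subn.
pose s := PComp PSucc [:: PProj 0].
exists (PMu (PComp ps [:: PComp PSucc [:: PProj 1]; PComp pm [:: s; s]])) => X n.
have sP r : computes X s [:: r; n] r.+1 by apply: computes_comp1.
have mP r : computes X
    (PComp ps [:: PComp PSucc [:: PProj 1]; PComp pm [:: s; s]]) [:: r; n]
    (n.+1 - r.+1 * r.+1).
  apply: computes_comp2; last exact: psP; first exact: computes_comp1.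
  by apply: computes_comp2; last exact: pmP.
have /andP[rn nr] := root_natP n; split.
  by rewrite [X in computes _ _ _ X](_ : 0 = n.+1 - (root_nat n).+1 * (root_nat n).+1);
    [exact: mP | nia].
move=> m mr; exists (n - m.+1 * m.+1); rewrite -subSn; first exact: mP.
by nia.
Qed.

Lemma raw_if : exists p, forall X (b : bool) x y,
  computes X p [:: (b : nat); x; y] (if b then x else y).
Proof.
exists (PRec (PProj 1) (PProj 2)) => X b x y.
have -> : (if b then x else y) = (fun i => if i == 1 then x else y) b by case: b.
apply: (computes_rec (h := fun i => if i == 1 then x else y)) => //.
by case=> [|i] //; case: (b) => //.
Qed.

End RawPrograms.

Section EffectiveBase.
Local Open Scope nat_scope.
Variable D : set (nat -> nat).
Context {A B C : Type} {cA : coded A} {cB : coded B} {cC : coded C}.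

(** Since only codes matter, a map may be computed through another map with
    the same codes, even if its codomain is another type. *)
Lemma eff_code (f : (nat -> nat) -> A -> B) (g : (nat -> nat) -> A -> C) :
  effective D g -> (forall X a, D X -> encode (f X a) = encode (g X a)) ->
  effective D f.
Proof. by move=> [p pP] fg; exists p => X DX a; rewrite fg //; exact: pP. Qed.

Lemma eff_id : effective D (fun X (a : A) => a).
Proof. by exists (PProj 0). Qed.

Lemma eff_const (b : B) : effective D (fun X (a : A) => b).
Proof.
exists (iter (encode b) (fun p => PComp PSucc [:: p]) PZero) => X _ a.
by elim: (encode b) => //= n IHn; exists [:: n].
Qed.

Lemma eff_comp (g : (nat -> nat) -> B -> C) (f : (nat -> nat) -> A -> B) :
  effective D g -> effective D f -> effective D (fun X a => g X (f X a)).
Proof.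
move=> [p pP] [q qP]; exists (PComp p [:: q]) => X DX a.
by apply: computes_comp1; [exact: qP | exact: pP].
Qed.

Lemma eff_oracle (f : (nat -> nat) -> A -> nat) :
  effective D f -> effective D (fun X a => X (f X a)).
Proof.
move=> [p pP]; exists (PComp POracle [:: p]) => X DX a.
by apply: computes_comp1; first exact: pP.
Qed.

Lemma eff_raw2 op (f g : (nat -> nat) -> A -> nat) : raw_op2 op ->
  effective D f -> effective D g -> effective D (fun X a => op (f X a) (g X a)).
Proof.
move=> [c cP] [p pP] [q qP]; exists (PComp c [:: p; q]) => X DX a.
by apply: computes_comp2; [exact: pP | exact: qP | exact: cP].
Qed.

Lemma eff_pair (f : (nat -> nat) -> A -> B) (g : (nat -> nat) -> A -> C) :
  effective D f -> effective D g -> effective D (fun X a => (f X a, g X a)).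
Proof.
have [c cP] := raw_code_pair.
move=> [p pP] [q qP]; exists (PComp c [:: p; q]) => X DX a.
by apply: computes_comp2; [exact: pP | exact: qP | exact: cP].
Qed.

Lemma eff_if (b : (nat -> nat) -> A -> bool) (f g : (nat -> nat) -> A -> B) :
  effective D b -> effective D f -> effective D g ->
  effective D (fun X a => if b X a then f X a else g X a).
Proof.
have [c cP] := raw_if; move=> [r rP] [p pP] [q qP].
exists (PComp c [:: r; p; q]) => X DX a; rewrite (fun_if encode).
by apply: computes_comp3; [exact: rP | exact: pP | exact: qP | exact: cP].
Qed.

Lemma eff_root (f : (nat -> nat) -> A -> nat) :
  effective D f -> effective D (fun X a => root_nat (f X a)).
Proof.
have [c cP] := raw_root; move=> [p pP]; exists (PComp c [:: p]) => X DX a.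
by apply: computes_comp1; [exact: pP | exact: cP].
Qed.

End EffectiveBase.

Section EffectiveNat.
Local Open Scope nat_scope.
Variable D : set (nat -> nat).
Context {A : Type} {cA : coded A}.
Implicit Types f g : (nat -> nat) -> A -> nat.

Lemma eff_encode T (cT : coded T) (f : (nat -> nat) -> A -> T) :
  effective D f -> effective D (fun X a => encode (f X a) : nat).
Proof. by move=> fe; apply: (eff_code fe). Qed.

Lemma eff_addn f g : effective D f -> effective D g ->
  effective D (fun X a => f X a + g X a).
Proof. exact: eff_raw2 raw_addn. Qed.

Lemma eff_muln f g : effective D f -> effective D g ->
  effective D (fun X a => f X a * g X a).
Proof. exact: eff_raw2 raw_muln. Qed.

Lemma eff_subn f g : effective D f -> effective D g ->
  effective D (fun X a => f X a - g X a).
Proof. exact: eff_raw2 raw_subn. Qed.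

Lemma eff_succn f : effective D f -> effective D (fun X a => (f X a).+1).
Proof.
move=> fe; apply: (eff_code (g := fun X a => f X a + 1)).
  by apply: eff_addn => //; exact: eff_const.
by move=> X a _; rewrite addn1.
Qed.

Lemma eff_predn f : effective D f -> effective D (fun X a => (f X a).-1).
Proof.
move=> fe; apply: (eff_code (g := fun X a => f X a - 1)).
  by apply: eff_subn => //; exact: eff_const.
by move=> X a _; rewrite subn1.
Qed.

Lemma eff_unpair2 f : effective D f -> effective D (fun X a => unpair2 (f X a)).
Proof. by move=> fe; apply: eff_subn => //; apply: eff_muln; exact: eff_root. Qed.

Lemma eff_unpair1 f : effective D f -> effective D (fun X a => unpair1 (f X a)).
Proof. by move=> fe; apply: eff_subn; [exact: eff_root | exact: eff_unpair2]. Qed.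

Lemma eff_leq f g : effective D f -> effective D g ->
  effective D (fun X a => f X a <= g X a).
Proof.
move=> fe ge; apply: (eff_code (g := fun X a => 1 - (f X a - g X a))).
  by apply: eff_subn; [exact: eff_const | exact: eff_subn].
by move=> X a _; rewrite /leq; case: (_ - _).
Qed.

Lemma eff_negb (b : (nat -> nat) -> A -> bool) :
  effective D b -> effective D (fun X a => ~~ b X a).
Proof. by move=> be; apply: eff_if => //; exact: eff_const. Qed.

Lemma eff_andb (b b' : (nat -> nat) -> A -> bool) :
  effective D b -> effective D b' -> effective D (fun X a => b X a && b' X a).
Proof. by move=> be be'; apply: eff_if => //; exact: eff_const. Qed.

Lemma eff_orb (b b' : (nat -> nat) -> A -> bool) :
  effective D b -> effective D b' -> effective D (fun X a => b X a || b' X a).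
Proof. by move=> be be'; apply: eff_if => //; exact: eff_const. Qed.

Lemma eff_eqn f g : effective D f -> effective D g ->
  effective D (fun X a => f X a == g X a).
Proof.
move=> fe ge; apply: (eff_code (g := fun X a => (f X a <= g X a) && (g X a <= f X a))).
  by apply: eff_andb; exact: eff_leq.
by move=> X a _; rewrite eqn_leq.
Qed.

End EffectiveNat.

Section EffectiveRecursion.
Local Open Scope nat_scope.
Variable D : set (nat -> nat).
Context {A B C : Type} {cA : coded A} {cB : coded B} {cC : coded C}.

Lemma eff_fst (f : (nat -> nat) -> A -> B * C) :
  effective D f -> effective D (fun X a => (f X a).1).
Proof.
move=> /eff_encode/eff_unpair1 fe; apply: (eff_code fe) => X a _ /=.
by rewrite -[LHS]/(encode _) [in RHS]/encode /= /coded_pair code_pairK1.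
Qed.

Lemma eff_snd (f : (nat -> nat) -> A -> B * C) :
  effective D f -> effective D (fun X a => (f X a).2).
Proof.
move=> /eff_encode/eff_unpair2 fe; apply: (eff_code fe) => X a _ /=.
by rewrite -[LHS]/(encode _) [in RHS]/encode /= /coded_pair code_pairK2.
Qed.

Lemma eff_iteri (n : (nat -> nat) -> A -> nat)
    (s : (nat -> nat) -> nat -> B -> A -> B) (x : (nat -> nat) -> A -> B) :
  effective D n -> effective D (fun X (t : nat * B * A) => s X t.1.1 t.1.2 t.2) ->
  effective D x ->
  effective D (fun X a => iteri (n X a) (fun i r => s X i r a) (x X a)).
Proof.
have [c cP] := raw_code_pair.
move=> [pn pnP] [ps psP] [px pxP].
exists (PComp (PRec px (PComp ps [:: PComp c [:: PComp c [:: PProj 0; PProj 1]; PProj 2]]))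
  [:: pn; PProj 0]) => X DX a.
apply: computes_comp2; [exact: pnP | by [] | ].
apply: (computes_rec (h := fun m => encode (iteri m (fun i r => s X i r a) (x X a)))).
  exact: pxP.
move=> i _ /=; set r := iteri _ _ _.
apply: computes_comp1; last exact: (psP X DX (i, r, a)).
apply: computes_comp2; [|by []|exact: cP].
by apply: computes_comp2; [by []|by []|exact: cP].
Qed.

Lemma eff_mu (P : (nat -> nat) -> nat -> A -> bool) (f : (nat -> nat) -> A -> nat) :
  (forall X a, D X -> P X (f X a) a) ->
  (forall X a m, D X -> P X m a -> f X a <= m) ->
  effective D (fun X (t : nat * A) => P X t.1 t.2) -> effective D f.
Proof.
have [c cP] := raw_code_pair.
move=> Pf fmin /eff_negb[p pP].
exists (PMu (PComp p [:: PComp c [:: PProj 0; PProj 1]])) => X DX a.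
have P' m : computes X (PComp p [:: PComp c [:: PProj 0; PProj 1]])
    [:: m; encode a] (~~ P X m a).
  apply: computes_comp1; last exact: (pP X DX (m, a)).
  by apply: computes_comp2; [by []|by []|exact: cP].
split; first by have := P' (f X a); rewrite Pf.
move=> m mf; exists 0; have := P' m.
by case: (boolP (P X m a)) => // /(fmin _ _ _ DX); rewrite leqNgt mf.
Qed.

End EffectiveRecursion.
Section EffectiveApplication.
Variable D : set (nat -> nat).
Context {A B C E F : Type}.
Context {cA : coded A} {cB : coded B} {cC : coded C} {cE : coded E} {cF : coded F}.

Lemma eff_app2 (h : (nat -> nat) -> B -> C -> E) (f : (nat -> nat) -> A -> B)
    (g : (nat -> nat) -> A -> C) :
  effective D (fun X (t : B * C) => h X t.1 t.2) ->
  effective D f -> effective D g -> effective D (fun X a => h X (f X a) (g X a)).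
Proof. by move=> he fe ge; exact: (eff_comp he (eff_pair fe ge)). Qed.

Lemma eff_app3 (h : (nat -> nat) -> B -> C -> E -> F) (f : (nat -> nat) -> A -> B)
    (g : (nat -> nat) -> A -> C) (k : (nat -> nat) -> A -> E) :
  effective D (fun X (t : B * C * E) => h X t.1.1 t.1.2 t.2) ->
  effective D f -> effective D g -> effective D k ->
  effective D (fun X a => h X (f X a) (g X a) (k X a)).
Proof.
by move=> he fe ge ke; exact: (eff_comp he (eff_pair (eff_pair fe ge) ke)).
Qed.

End EffectiveApplication.

(** The dispatch is by syntactic matching: unification would look through
    definitions, and through instances of [coded] that are not determined. *)
Ltac eff_step := lazymatch goal with
  | |- effective _ (fun X a => a) => exact: eff_id
  | |- effective _ (fun X a => fst (@?f X a)) => apply: eff_fst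
  | |- effective _ (fun X a => snd (@?f X a)) => apply: eff_snd
  | |- effective _ (fun X a => (@?f X a, @?g X a)) => apply: eff_pair
  | |- effective _ (fun X a => if _ then _ else _) => apply: eff_if
  | |- effective _ (fun X a => S (@?f X a)) => apply: eff_succn
  | |- effective _ (fun X a => predn (@?f X a)) => apply: eff_predn
  | |- effective _ (fun X a => addn (@?f X a) (@?g X a)) => apply: eff_addn
  | |- effective _ (fun X a => muln (@?f X a) (@?g X a)) => apply: eff_muln
  | |- effective _ (fun X a => subn (@?f X a) (@?g X a)) => apply: eff_subn
  | |- effective _ (fun X a => leq (@?f X a) (@?g X a)) => apply: eff_leq
  | |- effective _ (fun X a => eq_op (@?f X a) (@?g X a)) => apply: eff_eqn
  | |- effective _ (fun X a => negb (@?b X a)) => apply: eff_negb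
  | |- effective _ (fun X a => andb (@?b X a) (@?c X a)) => apply: eff_andb
  | |- effective _ (fun X a => orb (@?b X a) (@?c X a)) => apply: eff_orb
  | |- effective _ (fun X a => iteri (@?n X a) (@?s X a) (@?x X a)) =>
      apply: eff_iteri
  | |- effective _ (fun X a => unpair1 (@?f X a)) => apply: eff_unpair1
  | |- effective _ (fun X a => unpair2 (@?f X a)) => apply: eff_unpair2
  | |- effective _ (fun X a => encode (@?f X a)) => apply: eff_encode
  end.

(** Functions of several arguments are effective as maps on tuples. *)
Ltac eff_head_function := match goal with
  | H : effective ?D ?f |- effective ?D ?f => exact: H
  | H : effective ?D ?f |- effective ?D (fun X a => ?f X (@?g X a)) =>
      apply: (eff_comp (f := g) H)
  | H : effective ?D (fun X t => ?h X t.1 t.2)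
    |- effective ?D (fun X a => ?h X (@?f X a) (@?g X a)) =>
      apply: (eff_app2 (f := f) (g := g) H)
  | H : effective ?D (fun X t => ?h X t.1.1 t.1.2 t.2)
    |- effective ?D (fun X a => ?h X (@?f X a) (@?g X a) (@?k X a)) =>
      apply: (eff_app3 (f := f) (g := g) (k := k) H)
  end.

Ltac eff := repeat first [exact: eff_const | eff_step | eff_head_function].

(** * Arithmetic and lists *)

Section EffectiveArithmetic.
Local Open Scope nat_scope.
Variable D : set (nat -> nat).
Context {A B : Type} {cA : coded A} {cB : coded B}.

Lemma eff_divn (f g : (nat -> nat) -> A -> nat) :
  effective D f -> effective D g -> effective D (fun X a => f X a %/ g X a).
Proof.
move=> fe ge.
apply: (eff_mu (P := fun X q a => (g X a == 0) || (f X a < q.+1 * g X a))).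
- move=> X a _; case: posnP => // g0 /=.
  by rewrite mulSn addnC {1}(divn_eq (f X a) (g X a)) ltn_add2l ltn_mod.
- move=> X a q _; case: posnP => [->|g0 /=]; first by rewrite divn0.
  by rewrite -ltn_divLR.
- by eff.
Qed.

Lemma eff_modn (f g : (nat -> nat) -> A -> nat) :
  effective D f -> effective D g -> effective D (fun X a => f X a %% g X a).
Proof.
move=> fe ge.
apply: (eff_code (g := fun X a => f X a - f X a %/ g X a * g X a)).
  by eff; exact: eff_divn.
move=> X a _; congr encode; apply/eqP; rewrite -(eqn_add2l (f X a %/ g X a * g X a)).
by rewrite -divn_eq subnKC // leq_trunc_div.
Qed.

Lemma eff_dvdn (f g : (nat -> nat) -> A -> nat) :
  effective D f -> effective D g -> effective D (fun X a => f X a %| g X a).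
Proof. by move=> fe ge; rewrite /dvdn; eff; exact: eff_modn. Qed.

Lemma eff_expn (f g : (nat -> nat) -> A -> nat) :
  effective D f -> effective D g -> effective D (fun X a => f X a ^ g X a).
Proof.
move=> fe ge.
apply: (eff_code (g := fun X a => iteri (g X a) (fun _ r => f X a * r) 1)).
  by eff.
move=> X a _; congr encode; elim: (g X a) => [|n IHn]; first exact: expn0.
by rewrite expnS IHn.
Qed.

Lemma eff_half (f : (nat -> nat) -> A -> nat) :
  effective D f -> effective D (fun X a => (f X a)./2).
Proof.
move=> fe; apply: (eff_code (g := fun X a => f X a %/ 2)).
  by apply: eff_divn; eff.
by move=> X a _; rewrite divn2.
Qed.

Lemma eff_odd (f : (nat -> nat) -> A -> nat) :
  effective D f -> effective D (fun X a => odd (f X a)).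
Proof.
move=> fe; apply: (eff_code (g := fun X a => f X a %% 2)).
  by apply: eff_modn; eff.
by move=> X a _; rewrite modn2.
Qed.

Lemma eff_exists (n : (nat -> nat) -> A -> nat)
    (P : (nat -> nat) -> nat -> A -> bool) :
  effective D n -> effective D (fun X (t : nat * A) => P X t.1 t.2) ->
  effective D (fun X a => [exists i : 'I_(n X a), P X i a]).
Proof.
move=> ne Pe.
have Pe' : effective D (fun X (t : nat * bool * A) => P X t.1.1 t.2).
  by apply: (eff_app2 (h := P) Pe); eff.
apply: (eff_code (g := fun X a => iteri (n X a) (fun i r => r || P X i a) false)).
  by eff.
move=> X a _; congr encode; elim: (n X a) => [|m IHm] /=.
  by apply/existsP => -[[]].
rewrite -IHm; apply/existsP/orP => [[i Pi]|[/existsP[i Pi]|Pm]].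
- case: (ltnP i m) => im; [left | right].
    by apply/existsP; exists (Ordinal im).
  by have -> : m = i by apply/eqP; rewrite eqn_leq im -ltnS ltn_ord.
- by exists (widen_ord (leqnSn m) i).
- by exists ord_max.
Qed.

Lemma eff_forall (n : (nat -> nat) -> A -> nat)
    (P : (nat -> nat) -> nat -> A -> bool) :
  effective D n -> effective D (fun X (t : nat * A) => P X t.1 t.2) ->
  effective D (fun X a => [forall i : 'I_(n X a), P X i a]).
Proof.
move=> ne Pe; apply: (eff_code
  (g := fun X a => ~~ [exists i : 'I_(n X a), ~~ P X i a])).
  by apply: eff_negb; apply: (eff_exists (P := fun X i a => ~~ P X i a)); eff.
move=> X a _; congr encode; rewrite negb_exists.
by apply: eq_forallb => i; rewrite negbK.
Qed.

(** ** Lists *)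

Lemma eff_cons (x : (nat -> nat) -> A -> B) (l : (nat -> nat) -> A -> seq B) :
  effective D x -> effective D l -> effective D (fun X a => x X a :: l X a).
Proof.
move=> xe le; apply: (eff_code (g := fun X a => (encode (x X a, l X a) : nat).+1)) => //.
by eff.
Qed.

Lemma eff_nilp (l : (nat -> nat) -> A -> seq B) :
  effective D l -> effective D (fun X a => nilp (l X a)).
Proof.
move=> le; apply: (eff_code (g := fun X a => (encode (l X a) : nat) == 0)).
  by eff.
by move=> X a _; case: (l X a).
Qed.

Lemma eff_head x0 (l : (nat -> nat) -> A -> seq B) :
  effective D l -> effective D (fun X a => head x0 (l X a)).
Proof.
move=> le; apply: (eff_code (g := fun X a => if nilp (l X a) then encode x0 else
  unpair1 (encode (l X a) : nat).-1)).
  by eff; exact: eff_nilp.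
by move=> X a _; case: (l X a) => //= x s; rewrite /nilp /= code_pairK1.
Qed.

Lemma eff_behead (l : (nat -> nat) -> A -> seq B) :
  effective D l -> effective D (fun X a => behead (l X a)).
Proof.
move=> le; apply: (eff_code (g := fun X a => unpair2 (encode (l X a) : nat).-1)).
  by eff.
move=> X a _; case: (l X a) => [|x s] /=; last by rewrite [in RHS]/encode /= code_pairK2.
by rewrite [in RHS]/encode /= /unpair2 /root_nat big_ord0.
Qed.

End EffectiveArithmetic.

Ltac eff_lib := lazymatch goal with
  | |- effective _ (fun X a => divn (@?f X a) (@?g X a)) => apply: eff_divn
  | |- effective _ (fun X a => modn (@?f X a) (@?g X a)) => apply: eff_modn
  | |- effective _ (fun X a => dvdn (@?f X a) (@?g X a)) => apply: eff_dvdn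
  | |- effective _ (fun X a => expn (@?f X a) (@?g X a)) => apply: eff_expn
  | |- effective _ (fun X a => half (@?f X a)) => apply: eff_half
  | |- effective _ (fun X a => odd (@?f X a)) => apply: eff_odd
  | |- effective _ (fun X a => nilp (@?l X a)) => apply: eff_nilp
  | |- effective _ (fun X a => cons (@?x X a) (@?l X a)) => apply: eff_cons
  | |- effective _ (fun X a => head _ (@?l X a)) => apply: eff_head
  | |- effective _ (fun X a => behead (@?l X a)) => apply: eff_behead
  end.
Ltac eff ::= repeat first [exact: eff_const | eff_step | eff_lib | eff_head_function].

Section EffectiveFold.
Local Open Scope nat_scope.
Variable D : set (nat -> nat).
Context {A B C : Type} {cA : coded A} {cB : coded B} {cC : coded C}.

Lemma size_encode (l : seq B) : size l <= encode l.
Proof.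
elim: l => //= x l IHl; rewrite ltnS (leq_trans IHl) // /code_pair.
exact: leq_addl.
Qed.

Lemma eff_foldl (x0 : B) (s : (nat -> nat) -> C -> B -> A -> C)
    (c : (nat -> nat) -> A -> C) (l : (nat -> nat) -> A -> seq B) :
  effective D (fun X (t : C * B * A) => s X t.1.1 t.1.2 t.2) ->
  effective D c -> effective D l ->
  effective D (fun X a => foldl (fun r y => s X r y a) (c X a) (l X a)).
Proof.
move=> se ce le.
pose step X a (t : C * seq B) :=
  if nilp t.2 then t else (s X t.1 (head x0 t.2) a, behead t.2).
apply: (eff_code (g := fun X a =>
  (iteri (encode (l X a)) (fun _ => step X a) (c X a, l X a)).1)).
  apply: eff_fst; apply: eff_iteri; [exact: eff_encode | | by eff].
  by rewrite /step; eff.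
move=> X a _; congr encode.
have main n r k : size k <= n ->
    iter n (step X a) (r, k) = (foldl (fun r y => s X r y a) r k, [::]).
  elim: n r k => [|n IHn] r [|y k] //= kn; rewrite -iterS iterSr.
    exact: IHn.
  by rewrite IHn.
have iteriE n t : iteri n (fun _ => step X a) t = iter n (step X a) t.
  by elim: n => //= n ->.
by rewrite iteriE main ?size_encode.
Qed.

Lemma eff_mkseq (n : (nat -> nat) -> A -> nat) (f : (nat -> nat) -> nat -> A -> B) :
  effective D n -> effective D (fun X (t : nat * A) => f X t.1 t.2) ->
  effective D (fun X a => mkseq (fun i => f X i a) (n X a)).
Proof.
move=> ne fe.
(* built from the back, since lists grow at the head *)
apply: (eff_code (g := fun X a => iteri (n X a) (fun i r => f X (n X a - i.+1) a :: r)
  [::])).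
  by eff; apply: (eff_app2 (h := f) fe); eff.
move=> X a _; congr encode; rewrite /mkseq.
have main m : m <= n X a ->
    iteri m (fun i r => f X (n X a - i.+1) a :: r) [::] =
    [seq f X i a | i <- iota (n X a - m) m].
  elim: m => //= m IHm mn; rewrite IHm ?(ltnW mn) //.
  by have -> : n X a - m = (n X a - m.+1).+1 by lia.
by rewrite main // subnn.
Qed.

End EffectiveFold.

(** * Integers and rationals *)

Section EffectiveNumbers.
Variable D : set (nat -> nat).
Context {A : Type} {cA : coded A}.
Implicit Types (m n : (nat -> nat) -> A -> nat) (x y : (nat -> nat) -> A -> int).
Implicit Types (p q : (nat -> nat) -> A -> rat).

Definition pos_int (z : int) : nat := if z is Posz n then n else 0%N.
Definition neg_int (z : int) : nat := if z is Negz n then n.+1 else 0%N.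

Lemma pos_subr_neg z : z = (pos_int z)%:Z - (neg_int z)%:Z.
Proof. by case: z => n /=; rewrite ?subr0// NegzE sub0r. Qed.

Lemma eff_pos_int x : effective D x -> effective D (fun X a => pos_int (x X a)).
Proof.
move=> xe; apply: (eff_code (g := fun X a =>
  if odd (encode (x X a)) then 0%N else (encode (x X a) : nat)./2)).
  by eff.
by move=> X a _; case: (x X a) => k; rewrite /encode /= odd_double // doubleK.
Qed.

Lemma eff_neg_int x : effective D x -> effective D (fun X a => neg_int (x X a)).
Proof.
move=> xe; apply: (eff_code (g := fun X a =>
  if odd (encode (x X a)) then (encode (x X a) : nat)./2.+1 else 0%N)).
  by eff.
by move=> X a _; case: (x X a) => k; rewrite /encode /= odd_double //= uphalf_double.
Qed.

Lemma eff_subz m n : effective D m -> effective D n ->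
  effective D (fun X a => (m X a)%:Z - (n X a)%:Z).
Proof.
move=> me ne; apply: (eff_code (g := fun X a => if (n X a <= m X a)%N
  then (2 * (m X a - n X a))%N else (2 * (n X a - m X a).-1).+1)).
  by eff.
move=> X a _; case: leqP => mn.
  by rewrite subzn // mul2n.
have -> : (m X a)%:Z - (n X a)%:Z = Negz (n X a - m X a).-1.
  by rewrite NegzE prednK ?subn_gt0// -subzn ?opprB // ltnW.
by rewrite mul2n.
Qed.

Lemma eff_ext T (cT : coded T) (f g : (nat -> nat) -> A -> T) :
  effective D g -> (forall X a, f X a = g X a) -> effective D f.
Proof. by move=> ge fg; apply: (eff_code ge) => X a _; rewrite fg. Qed.

Lemma eff_addz x y : effective D x -> effective D y ->
  effective D (fun X a => x X a + y X a).
Proof.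
move=> xe ye; apply: (eff_ext (g := fun X a =>
  (pos_int (x X a) + pos_int (y X a))%N%:Z - (neg_int (x X a) + neg_int (y X a))%N%:Z)).
  by apply: eff_subz; apply: eff_addn; (exact: eff_pos_int || exact: eff_neg_int).
move=> X a; rewrite {1}(pos_subr_neg (x X a)) {1}(pos_subr_neg (y X a)) !PoszD.
by ring.
Qed.

Lemma eff_oppz x : effective D x -> effective D (fun X a => - x X a).
Proof.
move=> xe; apply: (eff_ext (g := fun X a =>
  (neg_int (x X a))%:Z - (pos_int (x X a))%:Z)).
  by apply: eff_subz; (exact: eff_pos_int || exact: eff_neg_int).
by move=> X a; rewrite {1}(pos_subr_neg (x X a)) opprB.
Qed.

Lemma eff_mulz x y : effective D x -> effective D y ->
  effective D (fun X a => x X a * y X a).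
Proof.
move=> xe ye; apply: (eff_ext (g := fun X a =>
  (pos_int (x X a) * pos_int (y X a) + neg_int (x X a) * neg_int (y X a))%N%:Z -
  (pos_int (x X a) * neg_int (y X a) + neg_int (x X a) * pos_int (y X a))%N%:Z)).
  by apply: eff_subz; apply: eff_addn; apply: eff_muln;
    (exact: eff_pos_int || exact: eff_neg_int).
move=> X a; rewrite {1}(pos_subr_neg (x X a)) {1}(pos_subr_neg (y X a)).
rewrite !PoszD !PoszM; by ring.
Qed.

Lemma eff_ge0z x : effective D x -> effective D (fun X a => 0 <= x X a).
Proof.
move=> xe; apply: (eff_ext (g := fun X a => neg_int (x X a) == 0%N)).
  by eff; exact: eff_neg_int.
by move=> X a; case: (x X a).
Qed.

Lemma eff_numq p : effective D p -> effective D (fun X a => numq (p X a)).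
Proof.
move=> pe; apply: (eff_code (g := fun X a => unpair1 (encode (p X a)))).
  by eff.
by move=> X a _; rewrite /encode /= code_pairK1.
Qed.

Lemma eff_denq p : effective D p -> effective D (fun X a => `|denq (p X a)|%N).
Proof.
move=> pe; apply: (eff_code (g := fun X a => unpair2 (encode (p X a)))).
  by eff.
by move=> X a _; rewrite /encode /= code_pairK2.
Qed.

Lemma numq_ratio (z : int) (d : nat) : (0 < d)%N ->
  numq (z%:~R / d%:R) * d%:Z = z * denq (z%:~R / d%:R).
Proof.
move=> d0; have d0' : d%:R != 0 :> rat by rewrite pnatr_eq0 -lt0n.
set r : rat := _ / _; apply/eqP; rewrite -(eqr_int rat) !intrM /=; apply/eqP.
rewrite [(numq r)%:~R](_ : _ = r * (denq r)%:~R); last first.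
  by rewrite -{2}(divq_num_den r) mulfVK // intr_eq0 denq_neq0.
by rewrite /r pmulrn; field.
Qed.

(** Codes of rationals are in lowest terms. The reduced denominator can be
    found by search, as the least [m] that makes [z * m / d] an integer. *)
Lemma denq_ratio (z : int) (d : nat) : (0 < d)%N ->
  forall m : nat, (d %| `|z| * m)%N = (`|denq (z%:~R / d%:R : rat)| %| m)%N.
Proof.
move=> d0 m; set r : rat := z%:~R / d%:R.
have E : numq r * d%:Z = z * denq r by exact: numq_ratio.
have {E} : (`|numq r| * d = `|z| * `|denq r|)%N by rewrite -!abszM -E abszM.
have D0 : (0 < `|denq r|)%N by rewrite absz_denq_gt0 || rewrite absz_gt0 denq_neq0.
have cop := coprime_num_den r; move: (`|denq r|)%N D0 cop => e e0 cop E.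
rewrite -(dvdn_pmul2r e0) -mulnA [(m * e)%N]mulnC mulnA -E.
rewrite mulnAC [(d * e)%N]mulnC dvdn_pmul2r // Gauss_dvdr //.
by rewrite coprime_sym.
Qed.

Lemma eff_ratio x n : (forall X a, (0 < n X a)%N) -> effective D x -> effective D n ->
  effective D (fun X a => (x X a)%:~R / (n X a)%:R : rat).
Proof.
move=> n0 xe ne.
have xpe := eff_pos_int xe; have xne := eff_neg_int xe.
pose z X a := (pos_int (x X a) + neg_int (x X a))%N.
have zE X a : z X a = `|x X a|%N by rewrite /z; case: (x X a) => k; rewrite ?addn0.
pose den X a := `|denq ((x X a)%:~R / (n X a)%:R : rat)|%N.
have ze : effective D z by rewrite /z; eff.
have dene : effective D den.
  apply: (eff_mu (P := fun X k a => (0 < k)%N && (n X a %| z X a * k)%N)).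
  - move=> X a _; rewrite zE denq_ratio // dvdnn andbT /den.
    by rewrite absz_gt0 denq_neq0.
  - by move=> X a m _; rewrite zE denq_ratio // => /andP[m0 /dvdn_leq]; exact.
  - by eff.
pose num X a := (pos_int (x X a) * den X a %/ n X a)%N%:Z -
                (neg_int (x X a) * den X a %/ n X a)%N%:Z.
apply: (eff_code (g := fun X a => (num X a, den X a))).
  by apply: eff_pair => //; apply: eff_subz; eff.
move=> X a _; rewrite /encode /= /coded_pair /= /code_rat /den.
congr code_pair; congr code_int.
rewrite /num /den; set r := _ / _.
have E : numq r * (n X a)%:Z = x X a * denq r by exact: numq_ratio.
have dp : (`|denq r|%N)%:Z = denq r by rewrite gez0_abs // ltW.
have nX : 0 < (n X a)%:Z by rewrite ltz_nat.
move: E; rewrite -dp; case: (x X a) => k E /=; rewrite mul0n div0n ?subr0 ?sub0r.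
  have : 0 <= numq r by rewrite -(pmulr_lge0 _ nX) E.
  case: (numq r) E => // u; rewrite -!PoszM => -[<-] _.
  by rewrite mulnK.
have {}E : - numq r * (n X a)%:Z = k.+1%:Z * `|denq r|%N.
  by rewrite mulNr E NegzE mulNr opprK.
have : 0 <= - numq r by rewrite -(pmulr_lge0 _ nX) E.
rewrite -[numq r]opprK; case: (- numq r) E => // u; rewrite -!PoszM => -[<-] _.
by rewrite mulnK.
Qed.

End EffectiveNumbers.
Section EffectiveRationals.
Variable D : set (nat -> nat).
Context {A : Type} {cA : coded A}.
Implicit Types (p q : (nat -> nat) -> A -> rat).

Lemma eff_natq (n : (nat -> nat) -> A -> nat) :
  effective D n -> effective D (fun X a => (n X a)%:R : rat).
Proof.
move=> ne; apply: (eff_ext (g := fun X a =>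
  ((n X a)%:Z - 0%:Z)%:~R / (1%N)%:R)).
  by apply: eff_ratio => //; [apply: eff_subz; eff | eff].
by move=> X a; rewrite subr0 divr1 pmulrn.
Qed.

Lemma denq_natr (x : rat) : (`|denq x|%N)%:R = (denq x)%:~R :> rat.
Proof. by rewrite pmulrn gez0_abs // ltW. Qed.

Lemma eff_addq p q : effective D p -> effective D q ->
  effective D (fun X a => p X a + q X a).
Proof.
move=> pe qe; apply: (eff_ext (g := fun X a =>
  (numq (p X a) * ((`|denq (q X a)|%N)%:Z - 0%:Z) +
   numq (q X a) * ((`|denq (p X a)|%N)%:Z - 0%:Z))%:~R /
  (`|denq (p X a)| * `|denq (q X a)|)%N%:R)).
  apply: eff_ratio; first by move=> X a; rewrite muln_gt0 !absz_gt0 !denq_neq0.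
    by apply: eff_addz; (apply: eff_mulz; [exact: eff_numq | apply: eff_subz;
      [exact: eff_denq | eff]]).
  by apply: eff_muln; exact: eff_denq.
move=> X a; rewrite !subr0 natrM intrD !intrM -!pmulrn !denq_natr.
rewrite -{1}(divq_num_den (p X a)) -{1}(divq_num_den (q X a)).
by field; rewrite !intr_eq0 !denq_neq0.
Qed.

Lemma eff_mulq p q : effective D p -> effective D q ->
  effective D (fun X a => p X a * q X a).
Proof.
move=> pe qe; apply: (eff_ext (g := fun X a =>
  (numq (p X a) * numq (q X a))%:~R /
  (`|denq (p X a)| * `|denq (q X a)|)%N%:R)).
  apply: eff_ratio; first by move=> X a; rewrite muln_gt0 !absz_gt0 !denq_neq0.
    by apply: eff_mulz; exact: eff_numq.
  by apply: eff_muln; exact: eff_denq.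
move=> X a; rewrite natrM intrM !denq_natr.
rewrite -{1}(divq_num_den (p X a)) -{1}(divq_num_den (q X a)).
by field; rewrite !intr_eq0 !denq_neq0.
Qed.

Lemma eff_oppq p : effective D p -> effective D (fun X a => - p X a).
Proof.
move=> pe; apply: (eff_ext (g := fun X a =>
  (- numq (p X a))%:~R / (`|denq (p X a)|)%N%:R)).
  apply: eff_ratio; first by move=> X a; rewrite absz_gt0 denq_neq0.
    by apply: eff_oppz; exact: eff_numq.
  exact: eff_denq.
by move=> X a; rewrite denq_natr -{1}(divq_num_den (p X a)) intrN mulNr.
Qed.

Lemma eff_le0q p : effective D p -> effective D (fun X a => 0 <= p X a).
Proof.
move=> pe; apply: (eff_ext (g := fun X a => 0 <= numq (p X a))).
  by apply: eff_ge0z; exact: eff_numq.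
by move=> X a; rewrite numq_ge0.
Qed.

Lemma eff_leqq p q : effective D p -> effective D q ->
  effective D (fun X a => p X a <= q X a).
Proof.
move=> pe qe; apply: (eff_ext (g := fun X a => 0 <= q X a + - p X a)).
  by apply: eff_le0q; apply: eff_addq => //; exact: eff_oppq.
by move=> X a; rewrite subr_ge0.
Qed.

Lemma eff_normq p : effective D p -> effective D (fun X a => `|p X a|).
Proof.
move=> pe; apply: (eff_ext (g := fun X a =>
  if 0 <= p X a then p X a else - p X a)).
  by apply: eff_if => //; [exact: eff_le0q | exact: eff_oppq].
by move=> X a; case: ger0P.
Qed.

Lemma eff_invq p : effective D p -> effective D (fun X a => (p X a)^-1).
Proof.
move=> pe; have ne := eff_numq pe; have de := eff_denq pe.
pose d X a := (pos_int (numq (p X a)) + neg_int (numq (p X a)))%N.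
have dE X a : d X a = `|numq (p X a)|%N.
  by rewrite /d; case: (numq _) => k; rewrite ?addn0.
(* the denominator is padded so that it never vanishes *)
apply: (eff_ext (g := fun X a => if d X a == 0%N then 0 else
  (if 0 <= p X a then `|denq (p X a)|%N%:Z - 0%:Z else
   - (`|denq (p X a)|%N%:Z - 0%:Z))%:~R / (d X a).-1.+1%:R)).
  have de' : effective D d by rewrite /d; eff; [exact: eff_pos_int | exact: eff_neg_int].
  apply: eff_if; [by eff | by eff | apply: eff_ratio => //; last by eff].
  by apply: eff_if; [exact: eff_le0q | | apply: eff_oppz]; apply: eff_subz; eff.
move=> X a; rewrite !subr0 dE; case: eqVneq => [/eqP|].
  by rewrite absz_eq0 numq_eq0 => /eqP ->; rewrite invr0.
rewrite -lt0n => n0; rewrite prednK // gez0_abs; last exact: ltW.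
rewrite pmulrn abszE.
have -> : `|numq (p X a)|%:~R = `|p X a| * (denq (p X a))%:~R :> rat.
  rewrite intr_norm -{2}(divq_num_den (p X a)) normrM normfV.
  by rewrite [`|(denq _)%:~R|]gtr0_norm ?ltr0z // mulfVK // intr_eq0 denq_neq0.
have p0 : p X a != 0 by rewrite -numq_eq0 -absz_eq0 -lt0n.
have d0 : (denq (p X a))%:~R != 0 :> rat by rewrite intr_eq0 denq_neq0.
by case: ger0P => _; rewrite ?intrN; field; rewrite ?oppr_eq0 p0 d0.
Qed.

End EffectiveRationals.

Ltac eff_rat := lazymatch goal with
  | |- effective _ (fun X a => GRing.add (@?f X a) (@?g X a)) => apply: eff_addq
  | |- effective _ (fun X a => GRing.mul (@?f X a) (@?g X a)) => apply: eff_mulq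
  | |- effective _ (fun X a => GRing.opp (@?f X a)) => apply: eff_oppq
  | |- effective _ (fun X a => GRing.inv (@?f X a)) => apply: eff_invq
  | |- effective _ (fun X a => Num.norm (@?f X a)) => apply: eff_normq
  | |- effective _ (fun X a => Order.le (@?f X a) (@?g X a)) => apply: eff_leqq
  | |- effective _ (fun X a => GRing.natmul _ (@?n X a)) => apply: eff_natq
  end.
Ltac eff ::= repeat first [exact: eff_const | eff_step | eff_lib | eff_rat
  | eff_head_function].

Section EffectiveSums.
Variable D : set (nat -> nat).
Context {A : Type} {cA : coded A}.

Lemma eff_sumq (n : (nat -> nat) -> A -> nat) (f : (nat -> nat) -> nat -> A -> rat) :
  effective D n -> effective D (fun X (t : nat * A) => f X t.1 t.2) ->
  effective D (fun X a => \sum_(i < n X a) f X i a).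
Proof.
move=> ne fe; apply: (eff_ext (g := fun X a =>
  iteri (n X a) (fun i r => r + f X i a) 0)); first by eff.
move=> X a; elim: (n X a) => [|m IHm]; first by rewrite big_ord0.
by rewrite big_ord_recr /= IHm.
Qed.

Lemma eff_sumn (n : (nat -> nat) -> A -> nat) (f : (nat -> nat) -> nat -> A -> nat) :
  effective D n -> effective D (fun X (t : nat * A) => f X t.1 t.2) ->
  effective D (fun X a => \sum_(i < n X a) f X i a)%N.
Proof.
move=> ne fe; apply: (eff_ext (g := fun X a =>
  iteri (n X a) (fun i r => (r + f X i a)%N) 0%N)); first by eff.
move=> X a; elim: (n X a) => [|m IHm]; first by rewrite big_ord0.
by rewrite big_ord_recr /= IHm.
Qed.

End EffectiveSums.

(** * Evaluation of piecewise linear functions at rational points *)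

Definition interp (p q : rat * rat) (x : rat) : rat :=
  p.2 + (q.2 - p.2) / (q.1 - p.1) * (x - p.1).

Fixpoint plq_from (p : rat * rat) (s : seq (rat * rat)) (x : rat) : rat :=
  match s with
  | [::] => p.2
  | q :: s' => if x <= q.1 then interp p q x else plq_from q s' x
  end.

Definition plq (s : seq (rat * rat)) : rat -> rat :=
  plq_from (head (0, 0) s) (behead s).

Lemma pl_fun_ratr (R : realType) s x : pl_fun s (ratr x : R) = ratr (plq s x).
Proof.
rewrite /pl_fun /plq; move: (head _ _) (behead _) => p {}s.
elim: s p => //= q s IHs p; rewrite ler_rat; case: ifP => // _.
by rewrite /interp rmorphD rmorphM rmorphB.
Qed.

(** The recursion in [plq_from] changes its first argument, so that a left fold
    has to carry the last vertex along with the value, once it is found. *)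
Definition plq_step (x : rat) (st : rat * rat * (bool * rat)) (q : rat * rat) :=
  if st.2.1 then st else
  if x <= q.1 then (st.1, (true, interp st.1 q x)) else (q, (false, 0)).

Lemma plq_foldl p s x :
  (let st := foldl (plq_step x) (p, (false, 0)) s in
   if st.2.1 then st.2.2 else st.1.2) = plq_from p s x.
Proof.
elim: s p => //= q s IHs p; rewrite [plq_step x _ q]/plq_step /=.
by case: (x <= q.1); [elim: s {IHs} | exact: IHs].
Qed.

Lemma eff_plq D A (cA : coded A) (s : (nat -> nat) -> A -> seq (rat * rat))
    (x : (nat -> nat) -> A -> rat) :
  effective D s -> effective D x -> effective D (fun X a => plq (s X a) (x X a)).
Proof.
move=> se xe.
pose st X a := foldl (fun st q => plq_step (x X a) st q)
  (head (0, 0) (s X a), (false, 0 : rat)) (behead (s X a)).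
apply: (eff_ext (g := fun X a => if (st X a).2.1 then (st X a).2.2 else (st X a).1.2)).
  have ste : effective D st.
    apply: (eff_foldl (0, 0) (s := fun X st q a => plq_step (x X a) st q)); [|by eff..].
    by rewrite /plq_step /interp; eff.
  by eff.
by move=> X a; rewrite /plq -plq_foldl.
Qed.

(** * Injectivity of the codes *)

Lemma code_pair_inj a b c d : code_pair a b = code_pair c d -> a = c /\ b = d.
Proof.
move=> E; split.
  by rewrite -(code_pairK1 a b) E code_pairK1.
by rewrite -(code_pairK2 a b) E code_pairK2.
Qed.

Lemma code_int_inj : injective code_int.
Proof.
move=> [m|m] [n|n] //= => [/double_inj -> //|E|E|[/double_inj -> //]];
  by have := congr1 odd E; rewrite /= !odd_double.
Qed.

Lemma code_rat_inj : injective code_rat.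
Proof.
move=> x y /code_pair_inj[/code_int_inj xy dxy].
rewrite -(divq_num_den x) -(divq_num_den y) xy; congr (_ / _%:~R).
by rewrite -[denq x]gez0_abs ?(ltW (denq_gt0 _))// -[denq y]gez0_abs ?(ltW (denq_gt0 _)) ?dxy.
Qed.

Lemma code_vertices_inj : injective code_vertices.
Proof.
elim=> [|[a b] s IHs] [|[c d] t] //= [] /code_pair_inj[/code_pair_inj[]].
by move=> /code_rat_inj -> /code_rat_inj -> /IHs ->.
Qed.

(** * Decidable relations and prefixes of quantifiers *)

Section Prefixes.
Local Open Scope nat_scope.

(** Saying [yes] amounts to not computing the code of [false], which is a
    universal statement. *)
Lemma Sig1_rejects D A (cA : coded A) (r : (nat -> nat) -> A -> bool)
    (arg : seq nat -> A) (t : term) :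
  effective D r -> (forall X e, encode (arg e) = term_val X e t) ->
  exists2 phi, bounded_formula phi & forall X e, D X ->
    (r X (arg e) <-> forall w, ~ sat X (w :: e) phi).
Proof.
move=> [p pP] tP.
pose s i := if i is 1 then t else TZero.
have sP X e i : nth 0 [:: 0; term_val X e t] i = term_val X e (s i).
  by case: i => [|[|i]] //=; rewrite nth_default.
have [phi bphi phiP] := Sig1_call (args := fun X e => [:: term_val X e t])
  (out := fun _ _ => 0) (Sig1_computes p) sP.
exists phi => // X e DX; have := pP X DX (arg e); rewrite (tP X) => pe.
have reject : (exists w, sat X (w :: e) phi) <-> ~~ r X (arg e).
  rewrite -phiP; split; last by case: (r X _) pe.
  by move=> /(computes_functional pe); case: (r X _).
split=> [re w we|nw]; first by have := re; rewrite (negbTE (proj1 reject (ex_intro _ w we))).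
by apply/negPn/negP => /(proj2 reject)[w /nw].
Qed.

Definition TPair (t u : term) : term :=
  TAdd (TMul (TAdd t u) (TAdd t u)) u.

Lemma Sigma0_2_exists_forall D (r : (nat -> nat) -> nat * nat -> bool) :
  effective D r -> exists2 phi, Sigma0 2 phi &
    forall X, D X -> (sat X [::] phi <-> exists a, forall c, r X (a, c)).
Proof.
move=> re.
have [phi bphi phiP] := Sig1_rejects (arg := fun e => (nth 0 e 1, nth 0 e 0))
  (t := TPair (TVar 1) (TVar 0)) re (fun X e => erefl).
exists (FEx (FAll (FAll (FNot phi)))).
  apply: Sigma0_ex; apply: Sigma0_Pi0; do 2!apply: Pi0_all.
  by apply: Pi0_Sigma0; apply: Sigma0_bounded.
move=> X DX; split=> /= -[a ra]; exists a => c; last exact/(phiP X [:: c; a] DX).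
exact/(phiP X [:: c; a] DX).
Qed.

Lemma Pi0_3_forall_exists_forall D (r : (nat -> nat) -> nat * nat * nat -> bool) :
  effective D r -> exists2 phi, Pi0 3 phi &
    forall X, D X ->
      (sat X [::] phi <-> forall a, exists b, forall c, r X (a, b, c)).
Proof.
move=> re.
have [phi bphi phiP] := Sig1_rejects
  (arg := fun e => (nth 0 e 2, nth 0 e 1, nth 0 e 0))
  (t := TPair (TPair (TVar 2) (TVar 1)) (TVar 0)) re (fun X e => erefl).
exists (FAll (FEx (FAll (FAll (FNot phi))))).
  apply: Pi0_all; apply: Pi0_Sigma0; apply: Sigma0_ex; apply: Sigma0_Pi0.
  by do 2!apply: Pi0_all; apply: Pi0_Sigma0; apply: Sigma0_bounded.
move=> X DX; split=> /= ra a; have [b rb] := ra a; exists b => c;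
  exact/(phiP X [:: c; b; a] DX).
Qed.

(** ** Normal forms of formulas *)

Lemma eff_term D t : effective D (fun X (e : seq nat) => term_val X e t).
Proof.
elim: t => /= [i||t IHt|t IHt u IHu|t IHt u IHu|t IHt]; try by eff.
  have he : effective D (fun X (e : seq nat) => iter i behead e).
    by elim: i => [|i IHi] /=; eff.
  apply: (eff_ext (eff_head 0 he)) => X e.
  by elim: i e {he} => [|i IHi] e; rewrite ?iterSr -?IHi ?nth_behead ?nth0.
exact: (eff_oracle IHt).
Qed.

Lemma eff_bounded_formula D phi : bounded_formula phi ->
  effective D (fun X (e : seq nat) => `[< sat X e phi >]).
Proof.
elim: phi => //= [t u|t u|p IHp|p IHp q IHq|p IHp q IHq|t p IHp|t p IHp].
- move=> _; have te := eff_term D t; have ue := eff_term D u.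
  apply: (eff_ext (g := fun X e => term_val X e t == term_val X e u)); first by eff.
  by move=> X e; apply/asboolP/eqP.
- move=> _; have te := eff_term D t; have ue := eff_term D u.
  apply: (eff_ext (g := fun X e => term_val X e t < term_val X e u)); first by eff.
  by move=> X e; apply/asboolP/idP.
- move=> /IHp pe; apply: (eff_ext (g := fun X e => ~~ `[< sat X e p >])).
    exact: eff_negb.
  by move=> X e; rewrite asbool_neg.
- move=> /andP[/IHp pe /IHq qe].
  apply: (eff_ext (g := fun X e => `[< sat X e p >] && `[< sat X e q >])).
    exact: eff_andb.
  by move=> X e; rewrite asbool_and.
- move=> /andP[/IHp pe /IHq qe].
  apply: (eff_ext (g := fun X e => `[< sat X e p >] || `[< sat X e q >])).
    exact: eff_orb.
  by move=> X e; rewrite asbool_or.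
- move=> /IHp pe; have te := eff_term D t.
  apply: (eff_ext (g := fun X e =>
    [exists i : 'I_(term_val X e t), `[< sat X ((i : nat) :: e) p >]])).
    apply: (eff_exists (P := fun X i e => `[< sat X (i :: e) p >])) => //.
    by apply: (eff_comp pe); eff.
  move=> X e; apply/asboolP/existsP => [[n [nt pn]]|[n /asboolP pn]].
    by exists (Ordinal nt); apply/asboolP.
  by exists n.
- move=> /IHp pe; have te := eff_term D t.
  apply: (eff_ext (g := fun X e =>
    [forall i : 'I_(term_val X e t), `[< sat X ((i : nat) :: e) p >]])).
    apply: (eff_forall (P := fun X i e => `[< sat X (i :: e) p >])) => //.
    by apply: (eff_comp pe); eff.
  move=> X e; apply/asboolP/forallP => pn n; first exact/asboolP/pn.
  by move=> nt; have /asboolP := pn (Ordinal nt).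
Qed.

(** The semantic form of a prefix with [n] single quantifiers, the outermost
    one existential if [ex]. The type [A] varies along the recursion because
    every quantifier adds a number to the tuple that the matrix decides. *)
Fixpoint prefixed (D : set (nat -> nat)) (n : nat) (ex : bool) A (cA : coded A)
    (P : (nat -> nat) -> A -> Prop) : Prop :=
  if n is m.+1 then
    exists2 Q : (nat -> nat) -> nat * A -> Prop,
      prefixed D m (~~ ex) (coded_pair coded_nat cA) Q &
      forall X a, P X a <->
        if ex then exists k, Q X (k, a) else forall k, Q X (k, a)
  else exists2 r : (nat -> nat) -> A -> bool, effective D r &
    forall X a, P X a <-> r X a.

Lemma prefixed_comp D n ex A B (cA : coded A) (cB : coded B) P
    (f : (nat -> nat) -> B -> A) :
  effective D f -> prefixed D n ex cA P ->
  prefixed D n ex cB (fun X b => P X (f X b)).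
Proof.
elim: n ex A B cA cB P f => [|n IHn] ex A B cA cB P f fe /=.
  move=> [r re rP]; exists (fun X b => r X (f X b)); last by move=> X b.
  exact: (eff_comp re fe).
move=> [Q Qn QP]; exists (fun X t => Q X (t.1, f X t.2)); last by move=> X b.
by apply: (IHn _ _ _ _ _ _ (fun X t => (t.1, f X t.2)) _ Qn); eff.
Qed.

Lemma prefixed_dummy D n ex A (cA : coded A) P :
  prefixed D n (~~ ex) cA P -> prefixed D n.+1 ex cA P.
Proof.
move=> Pn; exists (fun X (t : nat * A) => P X t.2).
  by apply: (prefixed_comp (f := fun X (t : nat * A) => t.2)) Pn; eff.
move=> X a; case: ex {Pn}; split=> //; last by move/(_ 0).
  by move=> Pa; exists 0.
by case.
Qed.

(** This contracts two like quantifiers to one, over codes of pairs. *)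
Lemma prefixed_quantifier D n ex A (cA : coded A) (Q : (nat -> nat) -> nat * A -> Prop) :
  prefixed D n.+1 ex (coded_pair coded_nat cA) Q ->
  prefixed D n.+1 ex cA
    (fun X a => if ex then exists k, Q X (k, a) else forall k, Q X (k, a)).
Proof.
move=> [S Sn SP]; exists (fun X (t : nat * A) =>
  S X (unpair2 t.1, (unpair1 t.1, t.2))).
  apply: (prefixed_comp (f := fun X t => (unpair2 t.1, (unpair1 t.1, t.2)))) Sn.
  by eff.
move=> X a; case: ex {Sn} SP => SP; split.
- move=> [k /SP[j Sj]]; exists (code_pair k j).
  by rewrite code_pairK1 code_pairK2.
- by move=> [m Sm]; exists (unpair1 m); apply/SP; exists (unpair2 m).
- by move=> Qk m; have /SP := Qk (unpair1 m); exact.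
- move=> Sm k; apply/SP => j; have := Sm (code_pair k j).
  by rewrite code_pairK1 code_pairK2.
Qed.

Scheme Sigma0_minimal := Minimality for Sigma0 Sort Prop
  with Pi0_minimal := Minimality for Pi0 Sort Prop.
Combined Scheme Sigma0_Pi0_minimal from Sigma0_minimal, Pi0_minimal.

Lemma prefixed_formula D :
  (forall n phi, Sigma0 n phi ->
    prefixed D n true (coded_seq coded_nat) (fun X (e : seq nat) => sat X e phi)) /\
  (forall n phi, Pi0 n phi ->
    prefixed D n false (coded_seq coded_nat) (fun X (e : seq nat) => sat X e phi)).
Proof.
have bounded phi ex : bounded_formula phi ->
    prefixed D 0 ex (coded_seq coded_nat) (fun X (e : seq nat) => sat X e phi).
  move=> bphi; exists (fun X e => `[< sat X e phi >]).
    exact: eff_bounded_formula.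
  by move=> X e; split=> /asboolP.
have quant n ex phi :
    prefixed D n.+1 ex (coded_seq coded_nat) (fun X (e : seq nat) => sat X e phi) ->
    prefixed D n.+1 ex (coded_seq coded_nat) (fun X (e : seq nat) =>
      if ex then exists k, sat X (k :: e) phi else forall k, sat X (k :: e) phi).
  move=> phin; apply: (@prefixed_quantifier _ _ _ _ _ (fun X t => sat X (t.1 :: t.2) phi)).
  by apply: (prefixed_comp (f := fun X t => t.1 :: t.2)) phin; eff.
apply: Sigma0_Pi0_minimal.
- by move=> phi; exact: bounded.
- by move=> n phi _; exact: (@prefixed_dummy _ _ true).
- by move=> n phi _; exact: (quant n true).
- by move=> phi; exact: bounded.
- by move=> n phi _; exact: (@prefixed_dummy _ _ false).
- by move=> n phi _; exact: (quant n false).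
Qed.

Lemma Sigma0_2_normal_form B : baire_class (Sigma0 2) B ->
  exists2 r : (nat -> nat) -> nat * nat -> bool, effective setT r &
    forall X, B X <-> exists a, forall c, r X (a, c).
Proof.
move=> [phi phi2 phiP].
have [Q [S [r re rP] SP] QP] := proj1 (prefixed_formula setT) _ _ phi2.
exists (fun X t => r X (t.2, (t.1, [::]))).
  by apply: (eff_comp re); eff.
move=> X; rewrite phiP QP; split=> -[a ra]; exists a.
  by move=> c; apply/rP; have /SP := ra; exact.
by apply/SP => c; apply/rP; exact: (ra c).
Qed.

Lemma Pi0_3_normal_form B : baire_class (Pi0 3) B ->
  exists2 r : (nat -> nat) -> nat * nat * nat -> bool, effective setT r &
    forall X, B X <-> forall a, exists b, forall c, r X (a, b, c).
Proof.
move=> [phi phi3 phiP].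
have [Q [S [T [r re rP] TP] SP] QP] := proj2 (prefixed_formula setT) _ _ phi3.
exists (fun X t => r X (t.2, (t.1.2, (t.1.1, [::])))).
  by apply: (eff_comp re); eff.
move=> X; rewrite phiP QP; split=> H a; have := H a.
  by move=> /SP[b /TP Tb]; exists b => c; apply/rP; exact: Tb.
by move=> [b rb]; apply/SP; exists b; apply/TP => c; apply/rP; exact: (rb c).
Qed.

End Prefixes.
(** * Variation along the 4-adic grids *)

Section Grid.
Variable R : realType.
Implicit Types (F : R -> R) (x y : R) (S : nat -> bool).

Definition grid (n i : nat) : R := i%:R / (4 ^ n)%:R.

Definition increment F (n i : nat) : R := F (grid n i.+1) - F (grid n i).

Definition cell (n : nat) (x : R) : nat := Num.truncn (x * (4 ^ n)%:R).

Lemma pow4_gt0 n : 0 < (4 ^ n)%:R :> R.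
Proof. by rewrite ltr0n expn_gt0. Qed.

Lemma grid_ge0 n i : 0 <= grid n i.
Proof. by rewrite divr_ge0. Qed.

Lemma grid_le1 n i : (i <= 4 ^ n)%N -> grid n i <= 1.
Proof. by move=> i4; rewrite ler_pdivrMr ?pow4_gt0 // mul1r ler_nat. Qed.

Lemma grid_end n : grid n (4 ^ n) = 1.
Proof. by rewrite /grid divff // gt_eqF // pow4_gt0. Qed.

Lemma grid0 n : grid n 0 = 0.
Proof. by rewrite /grid mul0r. Qed.

Lemma grid_lt n i j : (grid n i < grid n j) = (i < j)%N.
Proof. by rewrite ltr_pM2r ?invr_gt0 ?pow4_gt0 // ltr_nat. Qed.

Lemma grid_step n i : grid n i.+1 - grid n i = ((4 ^ n)%:R)^-1.
Proof. by rewrite /grid -mulrBl -natr1 addrC addKr mul1r. Qed.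

Lemma cell_grid n x : 0 <= x -> grid n (cell n x) <= x < grid n (cell n x).+1.
Proof.
move=> x0; have := truncn_itv (mulr_ge0 x0 (ltW (pow4_gt0 n))).
by rewrite /grid ler_pdivrMr ?pow4_gt0 // ltr_pdivlMr ?pow4_gt0.
Qed.

Lemma cell_le n x y : x <= y -> (cell n x <= cell n y)%N.
Proof. by move=> xy; rewrite le_truncn // ler_wpM2r. Qed.

Lemma cell_le_end n x : x <= 1 -> (cell n x <= 4 ^ n)%N.
Proof.
move=> x1; rewrite leqNgt truncn_gt_nat -ltNge.
by rewrite (@le_lt_trans _ _ (4 ^ n)%:R) ?ltr_nat // ler_piMl.
Qed.

Lemma inv_pow_small (b : nat) (d : R) : (1 < b)%N -> 0 < d ->
  exists N, forall n, (N <= n)%N -> ((b ^ n)%:R)^-1 < d.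
Proof.
move=> b1 d0; exists (Num.bound d^-1) => n Nn.
have b0 : 0 < (b ^ n)%:R :> R by rewrite ltr0n expn_gt0 ltnW.
have dN : d^-1 < (Num.bound d^-1)%:R by rewrite archi_boundP // invr_ge0 ltW.
rewrite invf_plt ?posrE //; apply: lt_le_trans dN _.
by rewrite ler_nat (leq_trans Nn) // ltnW // ltn_expl.
Qed.

Lemma within_continuousP F : {within `[0, 1], continuous F} <->
  forall x, 0 <= x <= 1 -> forall e : R, 0 < e -> exists2 d : R, 0 < d &
    forall y, 0 <= y <= 1 -> `|x - y| < d -> `|F x - F y| < e.
Proof.
rewrite subspace_continuousP; split=> [Fc x x01 e e0|Fe x].
  have := Fc x; rewrite /= in_itv /= => /(_ x01) /cvgrPdist_lt /(_ e e0).
  rewrite near_withinE => /nbhs_ballP[d /= d0 dP]; exists d => // y y01 xy.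
  by apply: dP => //=; rewrite in_itv.
rewrite /= in_itv /= => x01; apply/cvgrPdist_lt => e e0.
have [d d0 dP] := Fe x x01 e e0.
rewrite near_withinE; apply/nbhs_ballP; exists d => //= y xy.
by rewrite in_itv => y01; exact: dP.
Qed.

(** Values at finitely many points are limits of values on the grids. *)
Lemma sum_on_grid_limit F m (l r : 'I_m -> R) (eta : R) :
  {within `[0, 1], continuous F} ->
  (forall i, [/\ 0 <= l i, l i <= r i & r i <= 1]) -> 0 < eta ->
  exists N, forall n, (N <= n)%N ->
    \sum_i `|F (r i) - F (l i)| <=
    \sum_i `|F (grid n (cell n (r i))) - F (grid n (cell n (l i)))| + eta.
Proof.
move=> /within_continuousP Fc lr eta0; set e := eta / (2 * m.+1%:R).
have e0 : 0 < e by rewrite divr_gt0 // mulr_gt0.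
have near x : 0 <= x <= 1 -> exists N, forall n, (N <= n)%N ->
    `|F x - F (grid n (cell n x))| < e.
  move=> x01; have [d d0 dP] := Fc x x01 e e0.
  have [N NP] := inv_pow_small (isT : 1 < 4)%N d0; exists N => n /NP nd.
  have /andP[x0 x1] := x01; have /andP[gx xg] := cell_grid n x0.
  apply: dP; first by rewrite grid_ge0 grid_le1 ?cell_le_end.
  rewrite ger0_norm ?subr_ge0 //; apply: lt_trans nd.
  by rewrite -(grid_step n (cell n x)) ltrD2r.
have /choice[Nr NrP] i : exists N, forall n, (N <= n)%N ->
    `|F (r i) - F (grid n (cell n (r i)))| < e.
  by apply: near; have [l0 lri ->] := lr i; rewrite (le_trans l0).
have /choice[Nl NlP] i : exists N, forall n, (N <= n)%N ->
    `|F (l i) - F (grid n (cell n (l i)))| < e.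
  by apply: near; have [-> lri r1] := lr i; rewrite (le_trans lri).
exists (\max_i (maxn (Nr i) (Nl i)))%N => n nN.
apply: (@le_trans _ _ (\sum_i
    (`|F (grid n (cell n (r i))) - F (grid n (cell n (l i)))| + 2 * e))).
  apply: ler_sum => i _.
  have := leq_trans (leq_bigmax i) nN; rewrite geq_max => /andP[/NrP nr /NlP nl].
  set a := F (grid _ _) in nr *; set b := F (grid _ _) in nl *.
  rewrite (_ : F (r i) - F (l i) = (a - b) + ((F (r i) - a) - (F (l i) - b))); last by ring.
  rewrite (le_trans (ler_normD _ _)) // lerD2l (le_trans (ler_normB _ _)) //.
  by rewrite mulr_natl mulr2n lerD // ltW.
rewrite big_split /= lerD2l sumr_const card_ord -mulr_natl /e.
rewrite [X in X <= _](_ : _ = m%:R / m.+1%:R * eta); last by field; rewrite ?nat1r ?natr1 pnatr_eq0.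
by rewrite ler_piMl ?(ltW eta0) // ler_pdivrMr ?ltr0n // mul1r ler_nat.
Qed.

Lemma norm_sub_grid_le F n a b : (a <= b)%N ->
  `|F (grid n b) - F (grid n a)| <= \sum_(a <= j < b) `|increment F n j|.
Proof.
move=> ab; rewrite -(telescope_sumr (fun j => F (grid n j)) ab).
exact: ler_norm_sum.
Qed.

(** Rounded to the grid, disjoint intervals still cover each cell at most
    once, and their total length grows by at most one cell each. *)
Lemma intervals_on_grid F m (l r : 'I_m -> R) n :
  (forall i, [/\ 0 <= l i, l i <= r i & r i <= 1]) ->
  (forall i j, i != j -> r i <= l j \/ r j <= l i) ->
  exists2 S : nat -> bool,
    \sum_i `|F (grid n (cell n (r i))) - F (grid n (cell n (l i)))| <=
      \sum_(j < 4 ^ n | S j) `|increment F n j| &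
    (\sum_(j < 4 ^ n) S j)%N%:R / (4 ^ n)%:R <=
      \sum_i (r i - l i) + m%:R / (4 ^ n)%:R.
Proof.
move=> lr disj; pose P i j := (cell n (l i) <= j < cell n (r i))%N.
exists (fun j => [exists i, P i j]).
  apply: (@le_trans _ _ (\sum_i \sum_(j < 4 ^ n | P i j) `|increment F n j|)).
    apply: ler_sum => i _; have [l0 lri r1] := lr i.
    apply: le_trans (norm_sub_grid_le F n (cell_le n lri)) _.
    rewrite (big_nat_widen _ _ (4 ^ n)) ?cell_le_end // big_geq_mkord /=.
    by rewrite (eq_bigl (fun j : 'I_(4 ^ n) => P i j)) // => j; rewrite /P andbC.
  rewrite (exchange_big_dep predT) /=; last by [].
  rewrite [leRHS]big_mkcond /=; apply: ler_sum => j _.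
  case: existsP => [[i Pij]|nP]; last first.
    by rewrite big_pred0 // => i; apply/negP => Pij; apply: nP; exists i.
  rewrite (big_pred1 i) // => k; apply/idP/eqP => [Pkj|-> //].
  apply/eqP; apply: contraT => /disj; move: Pij Pkj; rewrite /P.
  move=> /andP[li ir] /andP[lk kr] [/(cell_le n)|/(cell_le n)] rl.
    by have := leq_trans kr (leq_trans rl li); rewrite ltnn.
  by have := leq_trans ir (leq_trans rl lk); rewrite ltnn.
have p4 := pow4_gt0 n.
rewrite ler_pdivrMr // mulrDl mulfVK ?gt_eqF // mulr_suml.
apply: (@le_trans _ _ (\sum_i ((cell n (r i) - cell n (l i))%N%:R : R))).
  rewrite -natr_sum ler_nat.
  apply: (@leq_trans (\sum_(j < 4 ^ n) \sum_i P i j)%N).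
    apply: leq_sum => j _; case: existsP => // -[i Pij].
    by rewrite (bigD1 i) //= Pij.
  rewrite exchange_big /=; apply: leq_sum => i _.
  have [l0 lri r1] := lr i.
  rewrite -[leqRHS]muln1 -sum_nat_const_nat.
  rewrite (big_nat_widen _ _ (4 ^ n)) ?cell_le_end // big_geq_mkord [leqRHS]big_mkcond /=.
  by apply: leq_sum => j _; rewrite /P andbC; case: (_ && _).
rewrite (_ : m%:R = \sum_(i < m) 1); last by rewrite sumr_const card_ord.
rewrite -big_split /=; apply: ler_sum => i _.
have [l0 lri r1] := lr i.
have /andP[_ +] := cell_grid n l0; have /andP[+ _] := cell_grid n (le_trans l0 lri).
rewrite natrB ?cell_le // /grid ler_pdivrMr // ltr_pdivlMr // -natr1 mulrBl => a b.
by lra.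
Qed.

End Grid.
Section GridCriteria.
Variable R : realType.
Implicit Types (F : R -> R) (S : nat -> bool).

Lemma inv_succ_small (d : R) : 0 < d -> exists k, k.+1%:R^-1 < d.
Proof.
move=> d0; have [N NP] := inv_pow_small (isT : 1 < 2)%N d0.
by exists (2 ^ N).-1; rewrite prednK ?expn_gt0 // NP.
Qed.

Lemma disjoint_open_intervals (a b c d : R) : a < b -> c < d ->
  ~ (`]a, b[%classic `&` `]c, d[%classic !=set0) -> b <= c \/ d <= a.
Proof.
move=> ab cd nx; case: (leP b c) => [|cb]; first by left.
case: (leP d a) => [|ad]; first by right.
exfalso; apply: nx; exists ((Num.max a c + Num.min b d) / 2).
have lt : Num.max a c < Num.min b d by rewrite gt_max !lt_min ab cb ad cd.
have /andP[a1 c1] : (a < (Num.max a c + Num.min b d) / 2) &&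
    (c < (Num.max a c + Num.min b d) / 2).
  by rewrite -gt_max; lra.
have /andP[b1 d1] : ((Num.max a c + Num.min b d) / 2 < b) &&
    ((Num.max a c + Num.min b d) / 2 < d).
  by rewrite -lt_min; lra.
by split; rewrite /= in_itv /= ?a1 ?b1 ?c1 ?d1.
Qed.

(** By continuity the points of a partition can be moved to a fine grid at
    little cost, and then the variation grows if all grid points are added. *)
Lemma bounded_variation_grid F : {within `[0, 1], continuous F} ->
  bounded_variation 0 1 F <->
  exists M : nat, forall n, \sum_(i < 4 ^ n) `|increment F n i| <= M%:R.
Proof.
move=> Fc; split=> [[M MP]|[M MP]].
  exists (Num.bound `|M|) => n; apply: (@le_trans _ _ M); last first.
    exact: le_trans (ler_norm M) (ltW (archi_boundP (normr_ge0 M))).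
  pose s := mkseq (fun i => grid R n i.+1) (4 ^ n).
  have snth k : (k <= 4 ^ n)%N -> nth 1 (0 :: s) k = grid R n k.
    by case: k => [|k] kn; [rewrite grid0 | rewrite /= nth_mkseq].
  apply: MP; exists s.
    split; last by rewrite (last_nth 1) size_mkseq snth // grid_end.
    apply/(pathP 1) => i; rewrite size_mkseq => i4.
    by rewrite snth ?(ltnW i4) // nth_mkseq // grid_lt.
  rewrite /variation size_mkseq big_mkord; apply: eq_bigr => i _.
  by rewrite /comp !snth ?(ltnW (ltn_ord i)).
exists M%:R => _ [s sP <-]; rewrite /variation big_mkord.
have [sp _] := sP.
apply/ler_addgt0Pr => eta eta0.
have mono (i j : nat) : (i <= j <= size s)%N ->
    nth 1 (0 :: s) i <= nth 1 (0 :: s) j.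
  move=> /andP[ij js]; apply: (sorted_leq_nth le_trans lexx) => //.
  - by apply: sub_path sp => x y /ltW.
  - by rewrite inE ltnS (leq_trans ij).
have lr (i : 'I_(size s)) : [/\ 0 <= nth 1 (0 :: s) i,
    nth 1 (0 :: s) i <= nth 1 (0 :: s) i.+1 & nth 1 (0 :: s) i.+1 <= 1].
  have is_ := ltn_ord i; split; last exact: itv_partition_nth_le.
    by apply: (itv_partition_nth_ge _ sP); rewrite ltnS ltnW.
  by apply: mono; rewrite leqnSn.
have [N NP] := sum_on_grid_limit Fc lr eta0.
have disj (i j : 'I_(size s)) : i != j ->
    nth 1 (0 :: s) i.+1 <= nth 1 (0 :: s) j \/
    nth 1 (0 :: s) j.+1 <= nth 1 (0 :: s) i.
  rewrite neq_ltn => /orP[ij|ji]; [left | right]; apply: mono.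
    by rewrite ij ltnW.
  by rewrite ji ltnW.
have [S SP _] := intervals_on_grid F N lr disj.
apply: le_trans (NP N (leqnn _)) _; rewrite lerD2r (le_trans SP) //.
apply: le_trans (MP N); rewrite [leLHS]big_mkcond; apply: ler_sum => j _.
by case: ifP.
Qed.

(** Intervals moved to a fine grid become unions of cells, of a total length
    that still is below the given bound because that bound is strict. *)
Lemma absolutely_continuous_grid F : {within `[0, 1], continuous F} ->
  absolutely_continuous 0 1 F <->
  forall k : nat, exists m : nat, forall n S,
    ((\sum_(i < 4 ^ n) S i) * 2 ^ m <= 4 ^ n)%N ->
    \sum_(i < 4 ^ n | S i) `|increment F n i| <= k.+1%:R^-1.
Proof.
move=> Fc; split=> [AC k|grid_AC eps eps0].
  have [|d d0 dP] := AC k.+1%:R^-1; first by rewrite invr_gt0.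
  have [m mP] := inv_pow_small (isT : 1 < 2)%N d0; exists m => n S Sm.
  pose A := [pred i : 'I_(4 ^ n) | S i].
  have bigA (f : 'I_(4 ^ n) -> R) :
      \sum_(i < 4 ^ n | S i) f i = \sum_(i < #|A|) f (enum_val i).
    by rewrite -(big_enum_val f); apply: eq_bigl => i; rewrite inE.
  rewrite bigA; apply/ltW.
  apply: (dP #|A| (fun i : 'I_#|A| => grid R n (enum_val i))
    (fun i : 'I_#|A| => grid R n (enum_val i).+1)).
  - by move=> i; rewrite grid_ge0 grid_lt ltnSn grid_le1.
  - move=> i j _ _ [x []]; rewrite /= !in_itv /= => /andP[ix xi] /andP[jx xj].
    apply/enum_val_inj/val_inj/eqP; rewrite eqn_leq -ltnS -[X in _ && X]ltnS.
    by rewrite -!(grid_lt R n) (lt_trans ix xj) (lt_trans jx xi).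
  - apply: le_lt_trans (mP m (leqnn m)).
    under eq_bigr do rewrite grid_step.
    rewrite sumr_const card_ord -[leLHS]mulr_natl ler_pdivrMr ?pow4_gt0 // mulrC.
    rewrite ler_pdivlMr ?ltr0n ?expn_gt0 // -natrM ler_nat.
    by rewrite -sum1_card (eq_bigl (fun i : 'I_(4 ^ n) => S i)) ?big_mkcond //
      => i; rewrite inE.
have [k kP] := inv_succ_small (divr_gt0 eps0 (ltr0n _ 2)).
have [m mP] := grid_AC k.
have p2 : 0 < (2 ^ m)%:R :> R by rewrite ltr0n expn_gt0.
exists (2 ^ m)%:R^-1; first by rewrite invr_gt0.
move=> q l r lr triv lr_small.
have lr' i : [/\ 0 <= l i, l i <= r i & r i <= 1].
  by have [l0 /ltW lri r1] := lr i.
have disj i j : i != j -> r i <= l j \/ r j <= l i.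
  have [_ li _] := lr i; have [_ lj _] := lr j.
  move=> ij; apply: disjoint_open_intervals => // /(triv i j I I) ij'.
  by rewrite ij' eqxx in ij.
have [N1 N1P] := sum_on_grid_limit Fc lr' (divr_gt0 eps0 (ltr0n _ 2)).
have gap : 0 < ((2 ^ m)%:R^-1 - \sum_i (r i - l i)) / q.+1%:R.
  by rewrite divr_gt0 // subr_gt0.
have [N2 N2P] := inv_pow_small (isT : 1 < 4)%N gap.
pose n := maxn N1 N2.
have [S SF SN] := intervals_on_grid F n lr' disj.
apply: le_lt_trans (N1P n (leq_maxl _ _)) _.
apply: (@le_lt_trans _ _ (k.+1%:R^-1 + eps / 2)).
  2: by rewrite [ltRHS]splitr ltrD2r.
rewrite lerD2r (le_trans SF) //; apply: (mP n S).
rewrite -(ler_nat R) natrM -ler_pdivlMr // mulrC -ler_pdivrMr ?pow4_gt0 //.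
rewrite (le_trans SN) //.
have := N2P n (leq_maxr _ _); rewrite ltr_pdivlMr // => small.
rewrite addrC -lerBrDr; apply: le_trans (ltW small).
by rewrite mulrC ler_wpM2l ?invr_ge0 // ler_nat.
Qed.

End GridCriteria.
(** * Membership in the classes *)

Section Names.
Variable R : realType.
Implicit Types (F : CI R) (X : nat -> nat).

Definition names : set (nat -> nat) := [set X | exists F : CI R, is_name X F].

(** The default value does not matter on names, where injectivity of the codes
    makes the list unique. *)
Definition name_vertices X (N : nat) : seq (rat * rat) :=
  xget [::] [set s | code_vertices s = X (code_rat N.+1%:R^-1)].

Lemma pl_from_bounded p s :
  exists B, forall x : R, 0 <= x <= 1 -> `|pl_from p s x| <= B.
Proof.
elim: s p => [|q s IHs] p /=; first by exists `|ratr p.2|.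
have [B BP] := IHs q; set c : R := ratr ((q.2 - p.2) / (q.1 - p.1)).
exists (Num.max B (`|ratr p.2| + `|c| * (1 + `|ratr p.1|))) => x x01.
rewrite le_max; case: ifP => _; last by rewrite BP.
apply/orP; right; rewrite (le_trans (ler_normD _ _)) // lerD2l normrM.
rewrite ler_wpM2l // (le_trans (ler_normB _ _)) // lerD2r.
by have /andP[x0 x1] := x01; rewrite ger0_norm.
Qed.

(** The supremum of an unbounded set is 0 by convention, so a bound on the norm
    says something about values only because the difference is bounded. *)
Lemma le_supnorm F s x : 0 <= x <= 1 ->
  `|F x - pl_fun s x| <= supnorm (F \- pl_fun s).
Proof.
move=> x01; apply: ub_le_sup; last by exists x; rewrite //= in_itv.
have [B BP] := pl_from_bounded (head (0, 0) s) (behead s).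
have [M MP] : exists M, forall y, 0 <= y <= 1 -> `|F y| <= M.
  have [c _ cP] := EVT_max (@ler01 R) (@CI_continuous _ F).
  have [d _ dP] := EVT_min (@ler01 R) (@CI_continuous _ F).
  exists (`|F c| + `|F d|) => y y01; rewrite ler_norml; apply/andP; split.
    apply: (@le_trans _ _ (F d)); last by apply: dP; rewrite in_itv.
    by rewrite lerNl (le_trans (ler_norm _)) // normrN lerDr normr_ge0.
  apply: (@le_trans _ _ (F c)); first by apply: cP; rewrite in_itv.
  by rewrite (le_trans (ler_norm _)) // lerDl normr_ge0.
exists (M + B) => _ [y /= y01 <-]; rewrite in_itv /= in y01.
by rewrite (le_trans (ler_normB _ _)) // lerD ?MP // BP.
Qed.

Lemma name_verticesP X F N x : is_name X F -> 0 <= x <= 1 ->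
  `|F x - pl_fun (name_vertices X N) x| <= N.+1%:R^-1.
Proof.
move=> XF x01; have [|s [_ Xs sF]] := XF N.+1%:R^-1; first by rewrite invr_gt0.
have -> : name_vertices X N = s.
  rewrite /name_vertices Xs; apply: code_vertices_inj.
  by case: xgetP => [t -> //|/(_ s)] /=.
apply: le_trans (le_supnorm F s x01) (le_trans sF _).
by rewrite fmorphV /= ratr_nat.
Qed.

Lemma eff_name_vertices A (cA : coded A) (N : (nat -> nat) -> A -> nat) :
  effective names N -> effective names (fun X a => name_vertices X (N X a)).
Proof.
move=> Ne; apply: (eff_code (g := fun X a =>
  X (encode ((N X a).+1%:R^-1 : rat) : nat))).
  by apply: eff_oracle; eff.
move=> X a [F XF]; have [|s [_ Xs _]] := XF (N X a).+1%:R^-1.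
  by rewrite invr_gt0.
have : code_vertices (name_vertices X (N X a)) = X (code_rat (N X a).+1%:R^-1).
  by rewrite /name_vertices; case: xgetP => [t -> //|/(_ s)] /=; rewrite Xs.
exact.
Qed.

Definition name_increment X (N n i : nat) : rat :=
  `|plq (name_vertices X N) (i.+1%:R / (4 ^ n)%N%:R) -
    plq (name_vertices X N) (i%:R / (4 ^ n)%N%:R)|.

Lemma eff_name_increment A (cA : coded A) (N n i : (nat -> nat) -> A -> nat) :
  effective names N -> effective names n -> effective names i ->
  effective names (fun X a => name_increment X (N X a) (n X a) (i X a)).
Proof.
move=> Ne ne ie; have ve := eff_name_vertices Ne.
by rewrite /name_increment; eff; apply: eff_plq; eff.
Qed.

Lemma name_increment_close X F N n i : is_name X F -> (i < 4 ^ n)%N ->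
  `| `|increment F n i| - ratr (name_increment X N n i)| <= 2 / N.+1%:R.
Proof.
move=> XF i4; rewrite /name_increment ratr_norm rmorphB /= -!pl_fun_ratr.
have E k : ratr (k%:R / (4 ^ n)%N%:R) = grid R n k :> R.
  by rewrite fmorph_div /= !ratr_nat.
have b k : (k <= 4 ^ n)%N -> `|F (grid R n k) - pl_fun (name_vertices X N) (grid R n k)|
    <= N.+1%:R^-1.
  by move=> k4; apply: name_verticesP => //; rewrite grid_ge0 grid_le1.
rewrite !E (le_trans (ler_dist_dist _ _)) // /increment.
set a := pl_fun _ _; set c := pl_fun _ _.
rewrite (_ : _ - _ = (F (grid R n i.+1) - a) - (F (grid R n i) - c)); last by ring.
rewrite (le_trans (ler_normB _ _)) // mulr_natl mulr2n lerD ?b //.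
exact: ltnW.
Qed.

(** The precision is divided by the number of cells, so that the total error
    does not depend on [n]. *)
Lemma name_sum_close X F n (d : nat) (S : nat -> bool) : is_name X F -> (0 < d)%N ->
  `| \sum_(i < 4 ^ n | S i) `|increment F n i| -
    ratr (\sum_(i < 4 ^ n) if S i then name_increment X (4 ^ n * d) n i else 0) |
  <= 2 / d%:R.
Proof.
move=> XF d0; rewrite rmorph_sum /= big_mkcond /= -sumrB.
apply: (@le_trans _ _ (\sum_(i < 4 ^ n) 2 / (4 ^ n * d).+1%:R)).
  apply: le_trans (ler_norm_sum _ _ _) _; apply: ler_sum => i _.
  case: ifP => _; first exact: name_increment_close.
  by rewrite rmorph0 subrr normr0 divr_ge0.
rewrite sumr_const card_ord -[leLHS]mulr_natl mulrCA ler_wpM2l //.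
rewrite ler_pdivrMr ?ltr0n // mulrC ler_pdivlMr ?ltr0n // -natrM ler_nat.
exact: leqnSn.
Qed.

(** Quantifiers over sets of cells become quantifiers over numbers. *)
Lemma bits_exist n (S : nat -> bool) :
  exists c, forall i, (i < n)%N -> odd (c %/ 2 ^ i) = S i.
Proof.
elim: n S => [|n IHn] S; first by exists 0%N.
have [c cP] := IHn (fun i => S i.+1); exists (S 0%N + c.*2)%N => -[_|i].
  by rewrite expn0 divn1 oddD odd_double addbF; case: (S 0%N).
move=> /cP <-; rewrite expnS divnMA divn2; congr (odd (_ %/ _)).
exact: half_bit_double.
Qed.

Lemma CI_class_bounded_variation :
  CI_class (Sigma0 2) [set F : CI R | bounded_variation 0 1 F].
Proof.
pose r X (t : nat * nat) :=
  \sum_(i < 4 ^ t.2) name_increment X (4 ^ t.2 * 1) t.2 i <= t.1%:R.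
have re : effective names r.
  rewrite /r; eff; apply: (eff_sumq (f := fun X i t =>
    name_increment X (4 ^ t.2 * 1) t.2 i)); first by eff.
  by apply: eff_name_increment; eff.
have [phi phi2 phiP] := Sigma0_2_exists_forall re.
exists phi => // F X XF; rewrite phiP; last by exists F.
rewrite /= (bounded_variation_grid (@CI_continuous _ F)).
have close n := name_sum_close n xpredT XF (ltn0Sn 0).
split=> -[M MP]; exists M.+2 => n; have := MP n; have := close n;
  rewrite /r /= divr1 ler_norml -(ler_rat R) ratr_nat -[in M.+2%:R]addn2 natrD;
  move=> /andP[? ?] ?; lra.
Qed.

Lemma CI_class_absolutely_continuous :
  CI_class (Pi0 3) [set F : CI R | absolutely_continuous 0 1 F].
Proof.
(* [n] and the bits of a subset of the cells are coded in one number *)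
pose r X (t : nat * nat * nat) :=
  let k := t.1.1 in let m := t.1.2 in let n := unpair1 t.2 in
  let S i := odd (unpair2 t.2 %/ 2 ^ i) in
  ~~ ((\sum_(i < 4 ^ n) S i) * 2 ^ m <= 4 ^ n)%N ||
  (\sum_(i < 4 ^ n) (if S i then name_increment X (4 ^ n * k.+1) n i else 0) <=
   3%:R / k.+1%:R).
have re : effective names r.
  rewrite /r /=; eff.
    apply: (eff_sumn (f := fun X i t => odd (unpair2 t.2 %/ 2 ^ i) : nat));
      first by eff.
    by apply: (eff_code (g := fun X (t : nat * (nat * nat * nat)) =>
      odd (unpair2 t.2.2 %/ 2 ^ t.1))) => //; eff.
  apply: (eff_sumq (f := fun X i t => if odd (unpair2 t.2 %/ 2 ^ i) then
    name_increment X (4 ^ unpair1 t.2 * t.1.1.+1) (unpair1 t.2) i else 0)).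
    by eff.
  by eff; apply: eff_name_increment; eff.
have [phi phi3 phiP] := Pi0_3_forall_exists_forall re.
exists phi => // F X XF; rewrite phiP; last by exists F.
rewrite /= (absolutely_continuous_grid (@CI_continuous _ F)).
have close n k S := @name_sum_close X F n k.+1 S XF (ltn0Sn k).
split=> H k.
  have [m mP] := H k; exists m => c; rewrite /r /=.
  set n := unpair1 c; set S := fun i => odd (unpair2 c %/ 2 ^ i).
  case: leqP => //= Sm; rewrite -(ler_rat R) fmorph_div /= !ratr_nat.
  have := close n k S; have := mP n S Sm.
  rewrite ler_norml mulr_natl mulr2n => a /andP[b c'].
  have -> : 3%:R / k.+1%:R = k.+1%:R^-1 + (k.+1%:R^-1 + k.+1%:R^-1) :> R by ring.
  by move: a b c'; move: (k.+1%:R^-1) => u; move: (ratr _) => v ? ? ?; lra.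
pose k' := (5 * k.+1).-1.
have [m mP] := H k'; exists m => n S Sm.
have [c cP] := bits_exist (4 ^ n) S.
have := mP (code_pair n c); rewrite /r /= code_pairK1 code_pairK2.
have -> : (\sum_(i < 4 ^ n) odd (c %/ 2 ^ i))%N = (\sum_(i < 4 ^ n) S i)%N.
  by apply: eq_bigr => i _; rewrite cP.
rewrite Sm /= => sumle.
have {sumle} : \sum_(i < 4 ^ n) (if S i then name_increment X (4 ^ n * k'.+1) n i
    else 0) <= 3%:R / k'.+1%:R.
  by apply: le_trans sumle; apply: ler_sum => i _; rewrite cP.
have := close n k' S.
rewrite -(ler_rat R) fmorph_div /= !ratr_nat ler_norml /k' => /andP[_ b] a.
have E : k.+1%:R^-1 = 5%:R * (5 * k.+1)%N%:R^-1 :> R.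
  rewrite natrM invfM mulrA divff ?mul1r // pnatr_eq0.
rewrite E; move: a b; rewrite !prednK ?muln_gt0 //.
by move: ((5 * k.+1)%N%:R^-1) => u; move: (ratr _) => v ? ?; lra.
Qed.

End Names.
(** * Functions with prescribed increments *)

Section Increments.
Variables (D : nat -> nat -> rat) (C : nat).

Definition partial_sum (n j : nat) : rat := \sum_(i < j) D n i.

(** [D n i] is to be the increment of a function over the [i]-th interval of
    length [1 / 4 ^ n]. The bound makes the partial sums at successive levels
    converge geometrically. *)
Definition consistent_increments :=
  (forall n i, \sum_(d < 4) D n.+1 (i * 4 + d) = D n i) /\
  (forall n i, `|D n i| <= C%:R / (2 ^ n)%N%:R).

Hypothesis Dcons : consistent_increments.

Lemma pow2_gt0 n : 0 < (2 ^ n)%N%:R :> rat.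
Proof. by rewrite ltr0n expn_gt0. Qed.

Lemma partial_sumS n j : partial_sum n j.+1 = partial_sum n j + D n j.
Proof. by rewrite /partial_sum big_ord_recr. Qed.

Lemma partial_sum_refine n j : partial_sum n.+1 (j * 4) = partial_sum n j.
Proof.
rewrite /partial_sum -!(big_mkord xpredT) big_nat_mul; apply: eq_bigr => i _.
rewrite -(proj1 Dcons) -{1}[(i * 4)%N]add0n big_addn mulSn addnK big_mkord.
by apply: eq_bigr => d _; rewrite addnC.
Qed.

Lemma partial_sum_refine_iter n k j :
  partial_sum (n + k) (j * 4 ^ k) = partial_sum n j.
Proof.
elim: k => [|k IHk]; first by rewrite addn0 muln1.
by rewrite addnS expnSr mulnA partial_sum_refine.
Qed.

Lemma partial_sum_child n j d : (d < 4)%N ->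
  `|partial_sum n.+1 (j * 4 + d) - partial_sum n j| <=
  (3 * C)%N%:R / (2 ^ n.+1)%N%:R.
Proof.
move=> d4; rewrite -(partial_sum_refine n j).
have -> : partial_sum n.+1 (j * 4 + d) =
    partial_sum n.+1 (j * 4) + \sum_(i < d) D n.+1 (j * 4 + i).
  elim: {d4} d => [|d IHd]; first by rewrite addn0 big_ord0 addr0.
  by rewrite addnS partial_sumS IHd big_ord_recr addrA.
rewrite addrC addKr; apply: le_trans (ler_norm_sum _ _ _) _.
apply: (@le_trans _ _ (\sum_(i < d) (C%:R / (2 ^ n.+1)%N%:R))).
  by apply: ler_sum => i _; exact: (proj2 Dcons).
rewrite sumr_const card_ord -[leLHS]mulr_natl mulrA -natrM.
by rewrite ler_pM2r ?invr_gt0 ?pow2_gt0 // ler_nat leq_mul2r -ltnS d4 orbT.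
Qed.

(** ** The limit function *)

Variable R : realType.
Implicit Types x y : R.

Definition approx (n : nat) x : R := ratr (partial_sum n (cell n x)).

Let err (n : nat) : R := (3 * C)%N%:R / (2 ^ n)%N%:R.

Let err_ge0 n : 0 <= err n.
Proof. by rewrite divr_ge0. Qed.

Let errS n : err n = err n.+1 + err n.+1.
Proof.
rewrite /err expnS natrM; field.
by rewrite pnatr_eq0 -lt0n expn_gt0.
Qed.

Lemma cellS n x : 0 <= x -> exists2 d, (d < 4)%N & cell n.+1 x = (cell n x * 4 + d)%N.
Proof.
move=> x0.
have lo : (cell n x * 4 <= cell n.+1 x)%N.
  rewrite /cell truncn_ge_nat ?mulr_ge0 // expnSr !natrM mulrA ler_pM2r //.
  by rewrite truncn_le mulr_ge0.
have hi : (cell n.+1 x < (cell n x).+1 * 4)%N.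
  rewrite /cell truncn_lt_nat ?mulr_ge0 // expnSr !natrM mulrA ltr_pM2r //.
  by have /andP[] := truncn_itv (mulr_ge0 x0 (ltW (pow4_gt0 R n))).
by exists (cell n.+1 x - cell n x * 4)%N; lia.
Qed.

Lemma approxS n x : 0 <= x -> `|approx n.+1 x - approx n x| <= err n.+1.
Proof.
move=> x0; have [d d4 cE] := cellS n x0.
have := partial_sum_child n (cell n x) d4.
rewrite -(ler_rat R) ratr_norm rmorphB /= -cE fmorph_div /= !ratr_nat.
exact.
Qed.

Lemma approx_bracket n m x : 0 <= x ->
  approx m x - err m <= approx n x + err n.
Proof.
move=> x0.
have up k : approx n x - err n <= approx (n + k) x - err (n + k) /\
    approx (n + k) x + err (n + k) <= approx n x + err n.
  elim: k => [|k [IHl IHr]]; first by rewrite addn0.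
  rewrite addnS; have := approxS (n + k) x0; have := errS (n + k).
  by rewrite ler_norml => E /andP[? ?]; split; lra.
have up' k : approx m x - err m <= approx (m + k) x - err (m + k).
  elim: k => [|k IHl]; first by rewrite addn0.
  rewrite addnS; have := approxS (m + k) x0; have := errS (m + k).
  by rewrite ler_norml => E /andP[? ?]; lra.
have [_ r] := up m; have l := up' n.
apply: le_trans l _; apply: le_trans r; rewrite addnC.
by have := err_ge0 (n + m); lra.
Qed.

(** Corrected by the error bound, the approximations increase to their limit,
    which thus is a supremum. *)
Definition limit_fun x : R := sup [set approx n x - err n | n in setT].

Lemma limit_fun_close n x : 0 <= x -> `|limit_fun x - approx n x| <= err n.
Proof.
move=> x0; have ub m : ubound [set approx n x - err n | n in setT] (approx m x + err m).
  by move=> _ [k _ <-]; exact: approx_bracket.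
have lo : approx n x - err n <= limit_fun x.
  by apply: ub_le_sup; [exists (approx n x + err n); exact: ub | exists n].
have hi : limit_fun x <= approx n x + err n.
  by apply: ge_sup; [exists (approx 0 x - err 0); exists 0%N | exact: ub].
by rewrite ler_norml; lra.
Qed.

Lemma err_small (e : R) : 0 < e -> exists n, err n < e.
Proof.
move=> e0; have d0 : 0 < e / (3 * C).+1%:R by rewrite divr_gt0.
have [N NP] := inv_pow_small (isT : 1 < 2)%N d0; exists N.
have := NP N (leqnn N); rewrite ltr_pdivlMr // => small.
apply: le_lt_trans small; rewrite /err mulrC ler_wpM2l ?invr_ge0 // ler_nat.
exact: leqnSn.
Qed.

Lemma cell_grid_eq n k j : cell (n + k) (grid R n j) = (j * 4 ^ k)%N.
Proof.
rewrite /cell /grid expnD !natrM mulrA divfK ?gt_eqF ?pow4_gt0 // -natrM.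
exact: natrK.
Qed.

(** A grid point stays the left end of its cell at all finer levels, where the
    partial sums do not change any more. *)
Lemma limit_fun_grid n j : limit_fun (grid R n j) = ratr (partial_sum n j).
Proof.
apply/eqP; rewrite -subr_eq0 -normr_le0; apply/ler_addgt0Pr => e e0.
rewrite add0r; have [k ke] := err_small e0.
have := limit_fun_close (n + k) (grid_ge0 R n j).
rewrite /approx cell_grid_eq partial_sum_refine_iter => /le_trans; apply.
apply: ltW; apply: le_lt_trans ke; rewrite /err ler_wpM2l //.
by rewrite lef_pV2 ?posrE ?ltr0n ?expn_gt0 // ler_nat leq_exp2l // leq_addl.
Qed.

Let D_err n i : `|ratr (D n i)| <= err n :> R.
Proof.
rewrite -ratr_norm (@le_trans _ _ (ratr (C%:R / (2 ^ n)%N%:R))) //.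
  by rewrite ler_rat; exact: (proj2 Dcons).
by rewrite fmorph_div /= !ratr_nat /err ler_pM2r ?invr_gt0 ?ltr0n ?expn_gt0 //
  ler_nat leq_pmull.
Qed.

(** On a closed cell the limit stays close to its value at the left end; at
    the right end the value belongs to the next cell. *)
Lemma limit_fun_cell n i x : grid R n i <= x <= grid R n i.+1 ->
  `|limit_fun x - ratr (partial_sum n i)| <= err n + err n.
Proof.
move=> /andP[ix xi]; have x0 := le_trans (grid_ge0 R n i) ix.
have := limit_fun_close n x0; rewrite /approx => close.
have ci : (i <= cell n x <= i.+1)%N.
  have ic := cell_le n ix; have ci := cell_le n xi.
  have E j : cell n (grid R n j) = j.
    by have := cell_grid_eq n 0 j; rewrite addn0 muln1.
  by rewrite !E in ic ci; rewrite ic ci.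
have [E|E] : cell n x = i \/ cell n x = i.+1 by lia.
  by rewrite E in close; rewrite (le_trans close) // lerDl.
move: close; rewrite E partial_sumS rmorphD /= => close.
rewrite (_ : _ - _ = (limit_fun x - (ratr (partial_sum n i) + ratr (D n i))) +
  ratr (D n i)); last by ring.
by rewrite (le_trans (ler_normD _ _)) // lerD.
Qed.

Lemma limit_fun_near n x y : 0 <= x -> x <= y -> y - x < ((4 ^ n)%:R)^-1 ->
  `|limit_fun x - limit_fun y| <= err n *+ 5.
Proof.
move=> x0 xy yx; have /andP[ix xi] := cell_grid n x0; set i := cell n x in ix xi.
have Fx : `|limit_fun x - ratr (partial_sum n i)| <= err n + err n.
  by apply: limit_fun_cell; rewrite ix ltW.
have Fy : `|limit_fun y - ratr (partial_sum n i)| <= err n + err n + err n.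
  case: (leP y (grid R n i.+1)) => yi.
    apply: (@le_trans _ _ (err n + err n)); last by rewrite lerDl.
    by apply: limit_fun_cell; rewrite (le_trans ix).
  have : `|limit_fun y - ratr (partial_sum n i.+1)| <= err n + err n.
    apply: limit_fun_cell; rewrite ltW //=.
    by have := grid_step R n i.+1; have := yx; lra.
  rewrite partial_sumS rmorphD /= => close.
  rewrite (_ : _ - _ = (limit_fun y - (ratr (partial_sum n i) + ratr (D n i))) +
    ratr (D n i)); last by ring.
  by rewrite (le_trans (ler_normD _ _)) // lerD.
rewrite (_ : _ - _ = (limit_fun x - ratr (partial_sum n i)) -
  (limit_fun y - ratr (partial_sum n i))); last by ring.
apply: le_trans (ler_normB _ _) _; apply: le_trans (lerD Fx Fy) _.
by rewrite !mulrS mulr0n; lra.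
Qed.

Lemma limit_fun_continuous : {within `[0, 1], continuous limit_fun}.
Proof.
apply/within_continuousP => x /andP[x0 x1] e e0.
have [n ne] := err_small (divr_gt0 e0 (ltr0n _ 5)).
have {}ne : err n *+ 5 < e by rewrite -mulr_natr -ltr_pdivlMr.
exists ((4 ^ n)%:R)^-1; first by rewrite invr_gt0 pow4_gt0.
move=> y /andP[y0 y1]; case: (leP x y) => xy.
  rewrite ler0_norm ?subr_le0 // opprB => yx.
  exact: le_lt_trans (limit_fun_near x0 xy yx) ne.
rewrite gtr0_norm ?subr_gt0 // => yx; rewrite distrC.
exact: le_lt_trans (limit_fun_near y0 (ltW xy) yx) ne.
Qed.

Let limit_fun_restrict := limit_fun \_ `[0, 1].

Let restrict_continuous : {within `[0, 1], continuous limit_fun_restrict}.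
Proof.
apply/within_continuousP => x x01 e e0.
have in01 z : 0 <= z <= 1 -> limit_fun_restrict z = limit_fun z.
  by move=> z01; rewrite /limit_fun_restrict patchE mem_set //= in_itv.
have [d d0 dP] := proj1 (within_continuousP _) limit_fun_continuous x x01 e e0.
by exists d => // y y01 xy; rewrite !in01 //; exact: dP.
Qed.

Let restrict_idem : limit_fun_restrict \_ `[0, 1] = limit_fun_restrict.
Proof.
by apply/funext => x; rewrite /limit_fun_restrict !patchE; case: (x \in _).
Qed.

Definition limit_CI : CI R := MkCI restrict_continuous restrict_idem.

Lemma limit_CI_E x : 0 <= x <= 1 -> limit_CI x = limit_fun x.
Proof. by move=> x01; rewrite /= /limit_fun_restrict patchE mem_set //= in_itv. Qed.

Lemma limit_CI_increment n i : (i < 4 ^ n)%N ->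
  increment limit_CI n i = ratr (D n i).
Proof.
move=> i4; rewrite /increment !limit_CI_E ?grid_ge0 ?grid_le1 ?(ltnW i4) //.
by rewrite !limit_fun_grid partial_sumS rmorphD /= addrC addKr.
Qed.

(** ** Piecewise linear approximations *)

Definition vertex (n j : nat) : rat * rat :=
  (j%:R / (4 ^ n)%N%:R, partial_sum n j).

Definition vertices (n : nat) : seq (rat * rat) := mkseq (vertex n) (4 ^ n).+1.

Lemma vertex_grid n j : ratr (vertex n j).1 = grid R n j.
Proof. by rewrite fmorph_div /= !ratr_nat. Qed.

Lemma pl_vertices_vertices n : pl_vertices (vertices n).
Proof.
rewrite /pl_vertices /vertices /mkseq /=; split; first by rewrite mul0r.
have p4 : 0 < (4 ^ n)%N%:R :> rat by rewrite ltr0n expn_gt0.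
rewrite /unzip1 -map_comp; set s := map _ _.
have snth k : (k <= 4 ^ n)%N -> nth 0 (0 :: s) k = k%:R / (4 ^ n)%N%:R.
  case: k => [|k] k4 /=; first by rewrite mul0r.
  by rewrite (nth_map 0%N) ?size_iota // nth_iota.
have ssize : size s = (4 ^ n)%N by rewrite size_map size_iota.
split; last by rewrite (last_nth 0) ssize snth // divff // gt_eqF.
apply/(pathP 0) => i; rewrite ssize => i4.
rewrite snth ?(ltnW i4) // -[ltRHS]/(nth 0 (0 :: s) i.+1) snth //.
by rewrite ltr_pM2r ?invr_gt0 // ltr_nat.
Qed.

Lemma interpolation_close n j x : grid R n j <= x <= grid R n j.+1 ->
  `|ratr (((vertex n j.+1).2 - (vertex n j).2) /
          ((vertex n j.+1).1 - (vertex n j).1)) * (x - grid R n j)| <= err n.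
Proof.
move=> /andP[jx xj]; rewrite fmorph_div /= !rmorphB /= -/(vertex n j).
rewrite -[ratr (j.+1%:R / _)]/(ratr (vertex n j.+1).1).
rewrite -[ratr (j%:R / _)]/(ratr (vertex n j).1) !vertex_grid partial_sumS.
rewrite rmorphD /= addrAC subrr add0r mulrAC -mulrA normrM.
rewrite -[leRHS]mulr1 ler_pM //.
have lt : 0 < grid R n j.+1 - grid R n j by rewrite subr_gt0 grid_lt.
rewrite ger0_norm; last by rewrite divr_ge0 ?(ltW lt) // subr_ge0.
by rewrite ler_pdivrMr // mul1r lerD2r.
Qed.

Lemma pl_from_vertices n m j x :
  grid R n j <= x <= grid R n (j + m.+1) ->
  exists2 i, grid R n i <= x <= grid R n i.+1 &
    `|pl_from (vertex n j) [seq vertex n i | i <- iota j.+1 m.+1] x -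
      ratr (partial_sum n i)| <= err n.
Proof.
elim: m j => [|m IHm] j /andP[jx xj].
  have xj1 : x <= grid R n j.+1 by rewrite addn1 in xj.
  exists j; first by rewrite jx.
  rewrite /= -[ratr (j.+1%:R / _)]/(ratr (vertex n j.+1).1) vertex_grid xj1.
  rewrite -[ratr (j%:R / _)]/(ratr (vertex n j).1) vertex_grid addrAC subrr add0r.
  by apply: interpolation_close; rewrite jx.
rewrite [iota _ _]/= map_cons.
have -> s : pl_from (vertex n j) (vertex n j.+1 :: s) x =
    if x <= grid R n j.+1 then ratr (vertex n j).2 +
      ratr (((vertex n j.+1).2 - (vertex n j).2) /
        ((vertex n j.+1).1 - (vertex n j).1)) * (x - grid R n j)
    else pl_from (vertex n j.+1) s x by rewrite -!vertex_grid.
case: leP => xj1; last first.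
  by apply: (IHm j.+1); rewrite ltW //= addSnnS.
exists j; first by rewrite jx.
rewrite [ratr _ + _]addrC addrK.
by apply: interpolation_close; rewrite jx.
Qed.

Lemma limit_CI_vertices n :
  supnorm (limit_CI \- @pl_fun R (vertices n)) <= (9 * C)%N%:R / (2 ^ n)%N%:R.
Proof.
apply: ge_sup.
  exists `|limit_CI 0 - pl_fun (vertices n) 0|; exists 0 => //=.
  by rewrite in_itv /= lexx ler01.
move=> _ [x x01 <-]; rewrite /= in_itv /= in x01.
have [m mE] : exists m, (4 ^ n = m.+1)%N.
  by case E : (4 ^ n)%N => [|m]; [have := expn_gt0 4 n; rewrite E | exists m].
have [i ix iV] := @pl_from_vertices n m 0 x
  ltac:(by rewrite add0n -mE grid0 grid_end).
rewrite -[X in `|X|]/(limit_CI x - pl_fun (vertices n) x) limit_CI_E //.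
have -> : pl_fun (vertices n) x =
    pl_from (vertex n 0) [seq vertex n i | i <- iota 1 m.+1] x.
  by rewrite /pl_fun /vertices /mkseq mE.
move: iV; set pl := pl_from _ _ _ => iV.
rewrite (_ : _ - _ = (limit_fun x - ratr (partial_sum n i)) -
  (pl - ratr (partial_sum n i))); last by ring.
apply: le_trans (ler_normB _ _) _.
apply: le_trans (lerD (limit_fun_cell ix) iV) _.
rewrite (_ : (9 * C)%N%:R / _ = err n + err n + err n) // /err !natrM.
by ring.
Qed.

End Increments.

(** The interpolation at level [m] has error [9 * C / 2 ^ m]. A program need not
    decode the precision: its code [c] satisfies [1 / c <= eps], so the level
    [c + 9 * C] is sufficient. *)
Theorem computable_from_increments (R : realType)
    (D : (nat -> nat) -> nat -> nat -> rat) (C : nat) :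
  (forall X, consistent_increments (D X) C) ->
  effective setT (fun X (t : nat * nat) => D X t.1 t.2) ->
  exists2 f : (nat -> nat) -> CI R, computable_to_CI f &
    forall X n i, (i < 4 ^ n)%N -> increment (f X) n i = ratr (D X n i).
Proof.
move=> Dcons De; exists (fun X => limit_CI (Dcons X) R); last first.
  by move=> X n i; exact: limit_CI_increment.
have [p pP] : effective setT (fun X (c : nat) => vertices (D X) (c + 9 * C)).
  rewrite /vertices /vertex.
  apply: (eff_mkseq (f := fun X j c =>
    (j%:R / (4 ^ (c + 9 * C))%N%:R : rat, partial_sum (D X) (c + 9 * C) j)));
    first by eff.
  eff; apply: (eff_sumq (f := fun X i t => D X (t.2 + 9 * C)%N i)); by eff.
exists p => X.
exists (fun c => code_vertices (vertices (D X) (c + 9 * C))); last first.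
  by move=> c; exact: (pP X I c).
move=> eps eps0; exists (vertices (D X) (code_rat eps + 9 * C)); split => //.
  exact: pl_vertices_vertices.
apply: le_trans (limit_CI_vertices (Dcons X) R _) _.
rewrite -(ratr_nat R (9 * C)) -(ratr_nat R (2 ^ _)) -fmorph_div ler_rat.
set c := code_rat eps.
have eps_c : c%:R^-1 <= eps.
  have den : (0 < `|denq eps|)%N by rewrite absz_gt0 denq_neq0.
  apply: (@le_trans _ _ (`|denq eps|%N%:R^-1)).
    rewrite lef_pV2 ?posrE ?ltr0n //; last first.
      by rewrite /c /code_rat /code_pair; lia.
    by rewrite ler_nat /c /code_rat /code_pair leq_addl.
  rewrite denq_natr -[leRHS]divq_num_den ler_peMl ?invr_ge0 ?ler0z //.
  by rewrite -[1]/(1%:~R) ler_int -gtz0_ge1 numq_gt0.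
apply: le_trans eps_c; have c0 : (0 < c)%N.
  have den : (0 < `|denq eps|)%N by rewrite absz_gt0 denq_neq0.
  by rewrite /c /code_rat /code_pair; lia.
rewrite ler_pdivrMr ?pow2_gt0 // mulrC ler_pdivlMr ?ltr0n // -natrM ler_nat.
by rewrite expnD mulnC leq_mul // ltnW // ltn_expl.
Qed.
(** * Completeness *)

(** ** Approximating an existential-universal statement by events *)

Section Events.
Local Open Scope nat_scope.

(** The candidate examined at stage [s]: it moves to the next number as soon
    as a counterexample to the present one is found. *)
Definition candidate (q : nat -> nat -> bool) (s : nat) : nat :=
  iteri s (fun i a => if [exists c : 'I_i.+1, ~~ q a c] then a.+1 else a) 0.

Definition event (q : nat -> nat -> bool) (s : nat) : bool :=
  [exists c : 'I_s.+1, ~~ q (candidate q s) c].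

Lemma candidateS q s : candidate q s.+1 =
  if event q s then (candidate q s).+1 else candidate q s.
Proof. by []. Qed.

Lemma candidate_mono q s t : s <= t -> candidate q s <= candidate q t.
Proof.
elim: t => [|t IHt]; first by rewrite leqn0 => /eqP ->.
rewrite leq_eqVlt => /orP[/eqP -> //|/IHt st]; rewrite candidateS.
by case: ifP => // _; rewrite leqW.
Qed.

Lemma finitely_many_events (q : nat -> nat -> bool) :
  (exists a, forall c, q a c) <-> exists N, forall s, N <= s -> ~~ event q s.
Proof.
split=> [[a qa]|[N Nq]].
  have le_a s : candidate q s <= a.
    elim: s => // s IHs; rewrite candidateS; case: ifP => // /existsP[c qc].
    rewrite ltn_neqAle IHs andbT; apply: contraNneq qc => ->; exact: qa.
  (* after a stage where the candidate is largest, it never moves *)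
  have ex : exists b, `[< exists s, candidate q s = b >].
    by exists 0; apply/asboolP; exists 0.
  have bnd b : `[< exists s, candidate q s = b >] -> b <= a.
    by move=> /asboolP[s <-].
  case: (ex_maxnP ex bnd) => b /asboolP[N Nb] bmax; exists N => s Ns.
  apply/negP => ev; have : candidate q s.+1 <= b.
    by apply: bmax; apply/asboolP; exists s.+1.
  rewrite candidateS ev -Nb ltnNge; apply/negP; rewrite negbK.
  exact: candidate_mono.
have stable s : N <= s -> candidate q s = candidate q N.
  elim: s => [|s IHs]; first by rewrite leqn0 => /eqP ->.
  rewrite leq_eqVlt => /orP[/eqP <- //|Ns].
  by rewrite candidateS (negbTE (Nq s Ns)) IHs.
exists (candidate q N) => c; apply: contraT => qc.
have := Nq (maxn N c) (leq_maxl _ _); rewrite /event stable ?leq_maxl //.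
have cN : c < (maxn N c).+1 by rewrite ltnS leq_maxr.
by rewrite negb_exists => /forallP /(_ (Ordinal cN)); rewrite qc.
Qed.

Lemma eff_event D A (cA : coded A) (q : (nat -> nat) -> A -> nat -> nat -> bool) :
  effective D (fun X (t : A * nat * nat) => q X t.1.1 t.1.2 t.2) ->
  effective D (fun X (t : A * nat) => event (q X t.1) t.2).
Proof.
move=> qe.
have se : effective D (fun X (t : nat * nat * A) =>
    [exists c : 'I_t.1.1.+1, ~~ q X t.2 t.1.2 c]).
  by apply: (eff_exists (P := fun X c t => ~~ q X t.2 t.1.2 c)); eff.
have ce : effective D (fun X (t : A * nat) => candidate (q X t.1) t.2).
  rewrite /candidate; apply: (eff_iteri (s := fun X i a t =>
    if [exists c : 'I_i.+1, ~~ q X t.1 a c] then a.+1 else a)); [by eff| |by eff].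
  apply: eff_if; [|by eff|by eff].
  by apply: (eff_app3 (h := fun X i a k => [exists c : 'I_i.+1, ~~ q X k a c]) se); eff.
apply: (eff_exists (P := fun X c t => ~~ q X t.1 (candidate (q X t.1) t.2) c)).
  by eff.
eff; by apply: (eff_comp ce); eff.
Qed.

End Events.

(** ** Recursion along base 4 digits *)

Section Descent.
Variable (step : nat -> nat -> rat -> rat) (r0 : rat).

(** The value at a cell, computed from the root through the digits of its
    index, the most significant one first. *)
Definition descend (n j : nat) : rat :=
  iteri n (fun s r => step s (j %/ 4 ^ (n - s.+1) %% 4)%N r) r0.

Lemma descendS n i d : (d < 4)%N ->
  descend n.+1 (i * 4 + d) = step n d (descend n i).
Proof.
move=> d4.
have main m : (m <= n)%N ->
    iteri m (fun s r => step s ((i * 4 + d) %/ 4 ^ (n.+1 - s.+1) %% 4)%N r) r0 =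
    iteri m (fun s r => step s (i %/ 4 ^ (n - s.+1) %% 4)%N r) r0.
  elim: m => //= m IHm mn; rewrite (IHm (ltnW mn)); congr step.
  have -> : (n.+1 - m.+1 = (n - m.+1).+1)%N by lia.
  by rewrite expnS divnMA divnMDl // (divn_small d4) addn0.
rewrite /descend [LHS]/= -/(iteri n _ _) main //.
by rewrite subnn expn0 divn1 modnMDl modn_small.
Qed.

End Descent.

Lemma eff_descend D A (cA : coded A)
    (step : (nat -> nat) -> A -> nat -> nat -> rat -> rat) (r0 : rat)
    (n j : (nat -> nat) -> A -> nat) :
  effective D (fun X (t : A * nat * nat * rat) => step X t.1.1.1 t.1.1.2 t.1.2 t.2) ->
  effective D n -> effective D j ->
  effective D (fun X a => descend (step X a) r0 (n X a) (j X a)).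
Proof.
move=> se ne je; rewrite /descend.
apply: (eff_iteri (s := fun X s r a =>
  step X a s (j X a %/ 4 ^ (n X a - s.+1) %% 4)%N r)) => //; last by eff.
apply: (eff_ext (g := fun X t => step X (t.2, t.1.1,
  (j X t.2 %/ 4 ^ (n X t.2 - t.1.1.+1) %% 4)%N, t.1.2).1.1.1
  (t.2, t.1.1, (j X t.2 %/ 4 ^ (n X t.2 - t.1.1.+1) %% 4)%N, t.1.2).1.1.2
  (t.2, t.1.1, (j X t.2 %/ 4 ^ (n X t.2 - t.1.1.+1) %% 4)%N, t.1.2).1.2
  (t.2, t.1.1, (j X t.2 %/ 4 ^ (n X t.2 - t.1.1.+1) %% 4)%N, t.1.2).2)) => //.
apply: (eff_comp (f := fun X t => (t.2, t.1.1,
  (j X t.2 %/ 4 ^ (n X t.2 - t.1.1.+1) %% 4)%N, t.1.2)) se).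
by eff.
Qed.

Lemma big_cells_split T (idx : T) (op : Monoid.law idx) n (f : nat -> T) :
  \big[op/idx]_(j < 4 ^ n.+1) f j =
  \big[op/idx]_(i < 4 ^ n) \big[op/idx]_(d < 4) f (i * 4 + d)%N.
Proof.
rewrite -(big_mkord xpredT f) expnSr big_nat_mul.
rewrite -(big_mkord xpredT (fun i => \big[op/idx]_(d < 4) f (i * 4 + d)%N)).
apply: eq_bigr => i _.
rewrite -{1}[(i * 4)%N]add0n big_addn mulSn addnK big_mkord.
by apply: eq_bigr => d _; rewrite addnC.
Qed.

Lemma sum4 (V : zmodType) (f : nat -> V) :
  \sum_(d < 4) f d = f 0%N + f 1%N + f 2%N + f 3%N.
Proof. by rewrite !big_ord_recr big_ord0 /= add0r. Qed.

(** ** Bounded variation *)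

Section Zigzag.
Variable t : nat -> bool.

(** An event [n] gives every cell of level [n] a zigzag of height [1 / 2 ^ n]:
    the function moves little, but it oscillates on [4 ^ n] cells. *)
Definition zigzag_step (n d : nat) (r : rat) : rat :=
  r / 4 + (if t n then (if odd d then -1 else 1) / (2 ^ n)%N%:R else 0).

Definition zigzag : nat -> nat -> rat := descend zigzag_step 0.

Lemma zigzagS n i d : (d < 4)%N ->
  zigzag n.+1 (i * 4 + d) = zigzag_step n d (zigzag n i).
Proof. exact: descendS. Qed.

Lemma zigzag_consistent : consistent_increments zigzag 4.
Proof.
split=> n i.
  rewrite (eq_bigr (fun d : 'I_4 => zigzag_step n d (zigzag n i))); last first.
    by move=> d _; rewrite zigzagS.
  rewrite (sum4 (fun d => zigzag_step n d _)) /zigzag_step /=.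
  by move: ((2 ^ n)%N%:R^-1) => h; case: (t n); lra.
elim: n i => [|n IHn] i; first by rewrite normr0 divr_ge0.
rewrite (divn_eq i 4) zigzagS ?ltn_mod // /zigzag_step.
have p2 := pow2_gt0 n.
rewrite expnS natrM invfM mulrA; apply: le_trans (ler_normD _ _) _.
rewrite (_ : 4 / 2 / _ = 4 / (2 ^ n)%N%:R / 4 + 1 / (2 ^ n)%N%:R); last first.
  by field; rewrite gt_eqF.
apply: lerD; first by rewrite normrM [`|4^-1|]ger0_norm // ler_pM2r.
case: (t n); last by rewrite normr0 divr_ge0.
by rewrite normrM [X in _ * X <= _]ger0_norm ?invr_ge0 // ler_pM2r ?invr_gt0 //;
  case: odd; rewrite ?normrN normr1.
Qed.

Definition zigzag_variation (n : nat) : rat := \sum_(i < 4 ^ n) `|zigzag n i|.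

(** Without an event the children of a cell inherit equal shares of its
    increment, so nothing cancels. *)
Lemma zigzag_variationS n : ~~ t n -> zigzag_variation n.+1 = zigzag_variation n.
Proof.
move=> tn; rewrite /zigzag_variation (big_cells_split _ n (fun j => `|zigzag n.+1 j|)).
apply: eq_bigr => i _.
rewrite (eq_bigr (fun _ => `|zigzag n i| / 4)) => [|d _].
  by rewrite sumr_const card_ord; field.
by rewrite zigzagS // /zigzag_step (negbTE tn) addr0 normrM [`|4^-1|]ger0_norm.
Qed.

(** Whatever the share [z] inherited from the parent, [z + h] and [z - h] have
    absolute values of sum at least [2 * h]. *)
Lemma zigzag_variation_event n : t n -> (2 ^ n)%N%:R <= zigzag_variation n.+1.
Proof.
move=> tn; rewrite /zigzag_variation (big_cells_split _ n (fun j => `|zigzag n.+1 j|)).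
apply: (@le_trans _ _ (\sum_(i < 4 ^ n) 1 / (2 ^ n)%N%:R)).
  rewrite sumr_const card_ord -[leRHS]mulr_natl mul1r.
  by rewrite ler_pdivlMr ?pow2_gt0 // -natrM ler_nat -expnMn.
apply: ler_sum => i _.
rewrite (eq_bigr (fun d : 'I_4 => `|zigzag_step n d (zigzag n i)|)); last first.
  by move=> d _; rewrite zigzagS.
rewrite (sum4 (fun d => `|zigzag_step n d _|)) /zigzag_step tn /=.
have h0 : 0 <= 1 / (2 ^ n)%N%:R :> rat by rewrite divr_ge0.
rewrite mulN1r mul1r in h0 *; move: (_^-1) h0 (zigzag n i / 4) => h h0 z.
have := ler_norm (z + h); have := normr_ge0 (z - h); have := ler_norm (- (z - h)).
by rewrite normrN; have := normr_ge0 (z + h); lra.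
Qed.

Lemma zigzag_bounded_variation :
  (exists M : nat, forall n, zigzag_variation n <= M%:R) <->
  exists N, forall s, (N <= s)%N -> ~~ t s.
Proof.
split=> [[M MP]|[N NP]].
  exists M => s Ms; apply/negP => /zigzag_variation_event.
  move=> /le_trans /(_ (MP s.+1)); rewrite ler_nat leqNgt.
  by rewrite (leq_ltn_trans Ms) // ltn_expl.
pose B := \sum_(n < N.+1) zigzag_variation n.
have v0 n : 0 <= zigzag_variation n by apply: sumr_ge0.
have le_B n : (n <= N)%N -> zigzag_variation n <= B.
  move=> nN; have nN' : (n < N.+1)%N by [].
  by rewrite /B (bigD1 (Ordinal nN')) //= lerDl sumr_ge0.
exists (Num.bound B) => n; apply: le_trans (ltW (archi_boundP _)); last exact: sumr_ge0.
elim: n => [|n IHn]; first exact: le_B.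
case: (leqP n.+1 N) => [|Nn]; first exact: le_B.
by rewrite zigzag_variationS // NP.
Qed.

End Zigzag.

Lemma norm_increment_ratr (R : realType) (F : R -> R) (D : nat -> nat -> rat) n
    (S : nat -> bool) :
  (forall i, (i < 4 ^ n)%N -> increment F n i = ratr (D n i)) ->
  \sum_(i < 4 ^ n | S i) `|increment F n i| =
  ratr (\sum_(i < 4 ^ n | S i) `|D n i|).
Proof.
move=> FD; rewrite rmorph_sum; apply: eq_bigr => i _.
by rewrite FD // -ratr_norm.
Qed.

Lemma bounded_variation_hard (R : realType) (B : set (nat -> nat)) :
  baire_class (Sigma0 2) B ->
  exists2 f : (nat -> nat) -> CI R, computable_to_CI f &
    f @^-1` [set F : CI R | bounded_variation 0 1 F] = B.
Proof.
move=> /Sigma0_2_normal_form[r re rP].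
pose t X := event (fun a c => r X (a, c)).
have te : effective setT (fun X (n : nat) => t X n).
  have re' : effective setT (fun X (t : nat * nat * nat) => r X (t.1.2, t.2)).
    by apply: (eff_comp re); eff.
  apply: (eff_comp (f := fun X n => (0%N, n))
    (eff_event (q := fun X _ a c => r X (a, c)) re')).
  by eff.
have ze : effective setT (fun X (u : nat * nat) => zigzag (t X) u.1 u.2).
  apply: (eff_descend (step := fun X u => zigzag_step (t X))); [|by eff..].
  by rewrite /zigzag_step; eff.
have [f fcomp fD] := computable_from_increments R (fun X => zigzag_consistent (t X)) ze.
exists f => //; apply/seteqP.
suff main X : bounded_variation 0 1 (f X) <-> B X by split=> X /main.
rewrite (bounded_variation_grid (@CI_continuous _ (f X))) rP.
rewrite (finitely_many_events (fun a c => r X (a, c))) -zigzag_bounded_variation.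
have E n := norm_increment_ratr xpredT (fD X n).
by split=> -[M MP]; exists M => n; have := MP n; rewrite E -(ratr_nat R) ler_rat.
Qed.
(** ** Absolute continuity *)

Section Mixture.
Variable t : nat -> nat -> bool.

Let active (k n : nat) : bool := (k <= n)%N && t k n.

(** At an event half of the children stay empty, so that the support loses half
    of its length. *)
Definition mass_step (k n d : nat) (r : rat) : rat :=
  if active k n then (if (d < 2)%N then r / 2 else 0) else r / 4.

Definition mass (k : nat) : nat -> nat -> rat := descend (mass_step k) 1.

Lemma massS k n i d : (d < 4)%N ->
  mass k n.+1 (i * 4 + d) = mass_step k n d (mass k n i).
Proof. exact: descendS. Qed.

Lemma mass_children k n i : \sum_(d < 4) mass k n.+1 (i * 4 + d) = mass k n i.
Proof.
rewrite (eq_bigr (fun d : 'I_4 => mass_step k n d (mass k n i))); last first.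
  by move=> d _; rewrite massS.
rewrite (sum4 (fun d => mass_step k n d _)) /mass_step /=.
by case: active; field.
Qed.

Lemma sum_mass k n : \sum_(i < 4 ^ n) mass k n i = 1.
Proof.
elim: n => [|n IHn]; first by rewrite expn0 big_ord1.
rewrite (big_cells_split _ n (mass k n.+1)) -[RHS]IHn; apply: eq_bigr => i _.
exact: mass_children.
Qed.

Lemma mass_ge0 k n i : 0 <= mass k n i.
Proof.
elim: n i => [|n IHn] i; first exact: ler01.
rewrite (divn_eq i 4) massS ?ltn_mod // /mass_step.
by case: ifP => _; [case: ifP => _ //|]; rewrite divr_ge0.
Qed.

(** Relative to an even spread, an event at most doubles the density of a cell,
    and there are no more than [minn n N] events before level [n]. *)
Lemma mass_le k n i N : (forall s, (N <= s)%N -> ~~ t k s) ->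
  mass k n i <= (2 ^ minn n N)%N%:R / (4 ^ n)%N%:R.
Proof.
move=> Nt; elim: n i => [|n IHn] i; first by rewrite min0n divr1.
rewrite (divn_eq i 4) massS ?ltn_mod // /mass_step.
have p4 : (4 ^ n)%N%:R != 0 :> rat by rewrite pnatr_eq0 -lt0n expn_gt0.
case: ifP => [/andP[_ tn]|_].
  have nN : (n < N)%N by rewrite ltnNge; apply: contraL tn => /Nt.
  have le2 : mass k n (i %/ 4) / 2 <= (2 ^ n.+1)%N%:R / (4 ^ n.+1)%N%:R.
    have := IHn (i %/ 4)%N; rewrite (minn_idPl (ltnW nN)) => le.
    rewrite !expnS !natrM (_ : _ / _ = (2 ^ n)%N%:R / (4 ^ n)%N%:R / 2); last by field.
    by rewrite ler_pM2r.
  by rewrite (minn_idPl nN); case: ifP => _; [exact: le2 | rewrite divr_ge0].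
apply: (@le_trans _ _ ((2 ^ minn n N)%N%:R / (4 ^ n)%N%:R / 4)).
  by rewrite ler_pM2r.
rewrite expnS natrM invfM [X in _ <= _ * X]mulrC mulrA ler_pM2r ?invr_gt0 //.
rewrite ler_pM2r ?invr_gt0 ?ltr0n ?expn_gt0 // ler_nat leq_exp2l //.
by rewrite leq_min !geq_min leqnSn leqnn orbT.
Qed.

(** Even at an event no child receives more than half of the mass. *)
Lemma mass_le_half k n i : mass k n i <= ((2 ^ n)%N%:R)^-1.
Proof.
elim: n i => [|n IHn] i; first by rewrite invr1.
rewrite (divn_eq i 4) massS ?ltn_mod // /mass_step expnS natrM invfM mulrC.
have := IHn (i %/ 4)%N; have := mass_ge0 k n (i %/ 4).
move: (mass _ _ _) ((2 ^ n)%N%:R^-1) => m h m0 mh.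
by case: ifP => _; [case: ifP => _|]; lra.
Qed.

(** No event of the [k]-th distribution takes place before level [k]. *)
Lemma mass_early k n i : (n <= k)%N -> mass k n i = ((4 ^ n)%N%:R)^-1.
Proof.
elim: n i => [|n IHn] i nk; first by rewrite invr1.
rewrite (divn_eq i 4) massS ?ltn_mod // /mass_step /active leqNgt nk /=.
by rewrite IHn; [rewrite expnSr natrM invfM | exact: ltnW].
Qed.

(** *** The mixture *)

Let weight (k : nat) : rat := ((2 ^ k.+1)%N%:R)^-1.

Let weight_ge0 k : 0 <= weight k. Proof. by rewrite invr_ge0. Qed.

Let sum_weight_sharp n K :
  \sum_(k < n) (if (k < K)%N then 0 else weight k) <=
  ((2 ^ K)%N%:R)^-1 - ((2 ^ maxn n K)%N%:R)^-1.
Proof.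
elim: n => [|n IHn]; first by rewrite big_ord0 max0n subrr.
rewrite big_ord_recr /=; apply: le_trans (lerD IHn (lexx _)) _.
case: ltnP => nK; first by rewrite (maxn_idPr nK) addr0.
rewrite (maxn_idPl (leqW nK)) /weight expnS natrM invfM.
by move: ((2 ^ K)%N%:R^-1) ((2 ^ n)%N%:R^-1) => u v; lra.
Qed.

Let sum_weight n K :
  \sum_(k < n) (if (k < K)%N then 0 else weight k) <= ((2 ^ K)%N%:R)^-1.
Proof.
by apply: le_trans (sum_weight_sharp n K) _; rewrite gerBl invr_ge0.
Qed.

(** The distributions with index at least [n], all even up to level [n], are
    lumped together in the last term. *)
Definition mixture (n i : nat) : rat :=
  \sum_(k < n) mass k n i * weight k + ((4 ^ n)%N%:R)^-1 / (2 ^ n)%N%:R.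

Lemma mixture_ge0 n i : 0 <= mixture n i.
Proof.
rewrite addr_ge0 ?mulr_ge0 ?invr_ge0 //.
by apply: sumr_ge0 => k _; rewrite mulr_ge0 ?mass_ge0.
Qed.

Lemma mixture_consistent : consistent_increments mixture 1.
Proof.
split=> n i.
  rewrite /mixture big_split /= exchange_big /= sumr_const card_ord.
  rewrite (eq_bigr (fun k : 'I_n.+1 => mass k n i * weight k)); last first.
    by move=> k _; rewrite -mulr_suml mass_children.
  rewrite big_ord_recr /= -addrA; congr (_ + _); rewrite mass_early // /weight.
  rewrite !expnS !natrM !invfM -[X in _ + X = _]mulr_natr.
  by move: ((4 ^ n)%N%:R^-1) ((2 ^ n)%N%:R^-1) => u v; field.
rewrite ger0_norm ?mixture_ge0 // mul1r.
set h : rat := ((2 ^ n)%N%:R)^-1; have h0 : 0 <= h by rewrite invr_ge0.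
apply: (@le_trans _ _ (\sum_(k < n) h * weight k + h * h)).
  apply: lerD; first by apply: ler_sum => k _; rewrite ler_wpM2r ?mass_le_half.
  rewrite ler_wpM2r // /h lef_pV2 ?posrE ?ltr0n ?expn_gt0 // ler_nat.
  by rewrite (expnMn 2 2 n) leq_pmulr ?expn_gt0.
rewrite -mulr_sumr -mulrDr ler_piMr //.
by have := sum_weight_sharp n 0; rewrite maxn0 invr1 lerBrDr.
Qed.

(** *** Finitely many events *)

Lemma sum_mixture n (S : nat -> bool) :
  \sum_(i < 4 ^ n | S i) mixture n i =
  \sum_(k < n) (\sum_(i < 4 ^ n | S i) mass k n i) * weight k +
  (\sum_(i < 4 ^ n) S i)%N%:R / (4 ^ n)%N%:R / (2 ^ n)%N%:R.
Proof.
rewrite big_split /= exchange_big /=; congr (_ + _).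
  by apply: eq_bigr => k _; rewrite mulr_suml.
rewrite -mulr_suml; congr (_ / _); rewrite natr_sum mulr_suml big_mkcond /=.
by apply: eq_bigr => i _; case: (S i); rewrite ?mul1r ?mul0r.
Qed.

Lemma sum_mass_le1 k n (S : nat -> bool) : \sum_(i < 4 ^ n | S i) mass k n i <= 1.
Proof.
rewrite -(sum_mass k n) big_mkcond; apply: ler_sum => i _.
by case: ifP => // _; exact: mass_ge0.
Qed.

(** Below [K] the densities are bounded; the distributions from [K] on have
    total weight [1 / 2 ^ K]. *)
Lemma mixture_absolutely_continuous :
  (forall k, exists N, forall s, (N <= s)%N -> ~~ t k s) ->
  forall b, exists m, forall n (S : nat -> bool),
    ((\sum_(i < 4 ^ n) S i) * 2 ^ m <= 4 ^ n)%N ->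
    \sum_(i < 4 ^ n | S i) `|mixture n i| <= b.+1%:R^-1.
Proof.
move=> /choice[N NP] b; pose K := (3 * b.+1)%N; pose P := (\sum_(k < K) N k)%N.
exists (P + K)%N => n S Sm.
rewrite (eq_bigr (fun i : 'I_(4 ^ n) => mixture n i)); last first.
  by move=> i _; rewrite ger0_norm ?mixture_ge0.
set card := (\sum_(i < 4 ^ n) S i)%N in Sm *.
set h : rat := ((2 ^ K)%N%:R)^-1; have h0 : 0 <= h by rewrite invr_ge0.
have p4 : 0 < (4 ^ n)%N%:R :> rat by rewrite ltr0n expn_gt0.
have density : card%:R / (4 ^ n)%N%:R <= ((2 ^ (P + K))%N%:R)^-1 :> rat.
  rewrite ler_pdivrMr // mulrC ler_pdivlMr ?pow2_gt0 // -natrM ler_nat.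
  exact: Sm.
have term (k : 'I_n) : (\sum_(i < 4 ^ n | S i) mass k n i) * weight k <=
    h * weight k + (if (k < K)%N then 0 else weight k).
  case: ltnP => kK; last first.
    by rewrite addrC -[leLHS]addr0 lerD ?mulr_ge0 // ler_piMl ?sum_mass_le1.
  rewrite addr0 ler_wpM2r //.
  apply: (@le_trans _ _ (\sum_(i < 4 ^ n | S i) (2 ^ P)%N%:R / (4 ^ n)%N%:R)).
    apply: ler_sum => i _; apply: le_trans (mass_le n i (NP k)) _.
    rewrite ler_pM2r ?invr_gt0 // ler_nat leq_exp2l // (leq_trans (geq_minr _ _)) //.
    by rewrite /P (bigD1 (Ordinal kK)) //= leq_addr.
  rewrite (_ : \sum_(_ < _ | _) _ = card%:R / (4 ^ n)%N%:R * (2 ^ P)%N%:R); last first.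
    rewrite /card natr_sum !mulr_suml big_mkcond /=; apply: eq_bigr => i _.
    by case: (S i); rewrite ?mul1r ?mul0r // mulrC.
  apply: le_trans (ler_wpM2r (ler0n _ _) density) _.
  by rewrite expnD natrM invfM mulrAC mulVf ?mul1r // gt_eqF ?pow2_gt0.
have last_term : card%:R / (4 ^ n)%N%:R / (2 ^ n)%N%:R <= h.
  rewrite ler_pdivrMr ?pow2_gt0 //; apply: le_trans density _.
  apply: (@le_trans _ _ h).
    by rewrite lef_pV2 ?posrE ?pow2_gt0 // ler_nat leq_exp2l // leq_addl.
  by rewrite ler_peMr // ler1n expn_gt0.
rewrite sum_mixture.
apply: (@le_trans _ _ (h + h + h)).
  apply: lerD last_term.
  apply: (@le_trans _ _ (\sum_(k < n)
    (h * weight k + (if (k < K)%N then 0 else weight k)))).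
    by apply: ler_sum => k _; exact: term.
  rewrite big_split /=.
  apply: lerD (sum_weight n K); rewrite -mulr_sumr ler_piMr //.
  by have := sum_weight n 0; rewrite invr1.
have <- : h *+ 3 = h + h + h by rewrite !mulrS mulr0n addr0 addrA.
rewrite -[leLHS]mulr_natl /h ler_pdivrMr ?pow2_gt0 // mulrC ler_pdivlMr ?ltr0n //.
by rewrite -natrM ler_nat ltnW // ltn_expl.
Qed.

(** *** Infinitely many events *)

Definition support (k n : nat) : nat := (\sum_(i < 4 ^ n) (mass k n i != 0%R))%N.

Definition events_before (k n : nat) : nat := (\sum_(s < n) active k s)%N.

(** Each event halves the share of the cells that the support occupies. *)
Lemma support_le k n : (support k n * 2 ^ events_before k n <= 4 ^ n)%N.
Proof.
elim: n => [|n IHn].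
  by rewrite /support /events_before expn0 big_ord1 big_ord0 muln1 leq_b1.
have supp : (support k n.+1 <= support k n * (if active k n then 2 else 4))%N.
  rewrite /support (big_cells_split _ n (fun i => mass k n.+1 i != 0 : nat)).
  rewrite big_distrl /=; apply: leq_sum => i _.
  rewrite (eq_bigr (fun d : 'I_4 => mass_step k n d (mass k n i) != 0 : nat)).
    rewrite !big_ord_recr big_ord0 /= /mass_step.
    case: ifP => _ /=; rewrite ?eqxx mulf_eq0 invr_eq0 !orbF;
      by case: (mass k n i == 0).
  by move=> d _; rewrite massS.
have -> : events_before k n.+1 = (events_before k n + active k n)%N.
  by rewrite /events_before big_ord_recr.
rewrite expnD; apply: leq_trans (leq_mul supp (leqnn _)) _.
move: IHn; rewrite [(4 ^ n.+1)%N]expnS; case: (active k n) => /=; lia.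
Qed.

Lemma many_events k : ~ (exists N, forall s, (N <= s)%N -> ~~ t k s) ->
  forall m, exists2 n, (k < n)%N & (m <= events_before k n)%N.
Proof.
move=> inf; have later N : exists2 s, (N <= s)%N & t k s.
  apply: contra_notP inf => no; exists N => s Ns; apply/negP => ts.
  by apply: no; exists s.
elim=> [|m [n kn mn]]; first by exists k.+1.
have [s ns ts] := later n; exists s.+1; first by rewrite ltnS (leq_trans _ ns) // ltnW.
rewrite /events_before big_ord_recr /= /active ts (leq_trans (ltnW kn)) // addn1 ltnS.
apply: leq_trans mn _; rewrite /events_before -!(big_mkord xpredT (fun s => active k s : nat)).
by rewrite [leqRHS](big_cat_nat (n := n)) //= leq_addr.
Qed.

(** After many events the [k]-th distribution lives on few cells, and they
    still carry its full share of the mixture. *)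
Lemma mixture_singular k : ~ (exists N, forall s, (N <= s)%N -> ~~ t k s) ->
  forall m, exists n (S : nat -> bool),
    ((\sum_(i < 4 ^ n) S i) * 2 ^ m <= 4 ^ n)%N /\
    weight k <= \sum_(i < 4 ^ n | S i) `|mixture n i|.
Proof.
move=> inf m; have [n kn mn] := many_events inf m.
exists n, (fun i => mass k n i != 0); split.
  by apply: leq_trans (support_le k n); rewrite leq_mul2l leq_exp2l // mn orbT.
apply: (@le_trans _ _ (\sum_(i < 4 ^ n | mass k n i != 0) mass k n i * weight k)).
  rewrite -mulr_suml [X in _ <= X * _](_ : _ = 1) ?mul1r // -[RHS](sum_mass k n).
  by rewrite big_mkcond; apply: eq_bigr => i _; case: eqVneq => [->|].
apply: ler_sum => i _; rewrite ger0_norm ?mixture_ge0 // /mixture.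
rewrite (bigD1 (Ordinal kn)) //= -addrA lerDl addr_ge0 //.
by apply: sumr_ge0 => j _; rewrite mulr_ge0 ?mass_ge0.
Qed.

(** In the singular case the [k]-th share of the mixture, [1 / 2 ^ (k + 1)],
    contradicts the bound with [b = 2 ^ (k + 1)]. *)
Lemma mixture_criterion :
  (forall b, exists m, forall n (S : nat -> bool),
    ((\sum_(i < 4 ^ n) S i) * 2 ^ m <= 4 ^ n)%N ->
    \sum_(i < 4 ^ n | S i) `|mixture n i| <= b.+1%:R^-1) <->
  forall k, exists N, forall s, (N <= s)%N -> ~~ t k s.
Proof.
split=> [AC k|]; last exact: mixture_absolutely_continuous.
apply: contrapT => /mixture_singular sing.
have [m mP] := AC (2 ^ k.+1)%N; have [n [S [Sm]]] := sing m.
move=> /le_trans /(_ (mP n S Sm)).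
by rewrite lef_pV2 ?posrE ?pow2_gt0 ?ltr0n // ler_nat ltnn.
Qed.

End Mixture.

Lemma eff_mixture D (t : (nat -> nat) -> nat -> nat -> bool) :
  effective D (fun X (u : nat * nat) => t X u.1 u.2) ->
  effective D (fun X (u : nat * nat) => mixture (t X) u.1 u.2).
Proof.
move=> te; rewrite /mixture; eff; apply: (eff_sumq (f := fun X k u =>
  mass (t X) k u.1 u.2 * ((2 ^ k.+1)%N%:R)^-1)); first by eff.
eff; apply: (eff_descend (step := fun X v => mass_step (t X) v.1)); [|by eff..].
by rewrite /mass_step; eff.
Qed.

Lemma absolutely_continuous_hard (R : realType) (B : set (nat -> nat)) :
  baire_class (Pi0 3) B ->
  exists2 f : (nat -> nat) -> CI R, computable_to_CI f &
    f @^-1` [set F : CI R | absolutely_continuous 0 1 F] = B.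
Proof.
move=> /Pi0_3_normal_form[r re rP].
pose t X k := event (fun a c => r X (k, a, c)).
have te : effective setT (fun X (u : nat * nat) => t X u.1 u.2).
  apply: (eff_event (q := fun X k a c => r X (k, a, c))).
  by apply: (eff_comp re); eff.
have [f fcomp fD] := computable_from_increments R
  (fun X => mixture_consistent (t X)) (eff_mixture te).
exists f => //; apply/seteqP.
suff main X : absolutely_continuous 0 1 (f X) <-> B X by split=> X /main.
rewrite (absolutely_continuous_grid (@CI_continuous _ (f X))) rP.
have -> : (forall k, exists a, forall c, r X (k, a, c)) <->
    (forall k, exists N, forall s, (N <= s)%N -> ~~ t X k s).
  by split=> H k; apply/(finitely_many_events (fun a c => r X (k, a, c))); exact: H.
rewrite -mixture_criterion.
have E n (S : nat -> bool) : \sum_(i < 4 ^ n | S i) `|increment (f X) n i| =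
    ratr (\sum_(i < 4 ^ n | S i) `|mixture (t X) n i|).
  exact: (norm_increment_ratr S (fD X n)).
split=> H b; have [m mP] := H b; exists m => n S /mP;
  by rewrite E -(ratr_nat R b.+1) -fmorphV ler_rat.
Qed.

Theorem theorem3 (R : realType) :
  complete (Sigma0 2) [set F : CI R | bounded_variation 0 1 F] /\
  complete (Pi0 3) [set F : CI R | absolutely_continuous 0 1 F].
Proof.
split; split.
- exact: CI_class_bounded_variation.
- exact: bounded_variation_hard.
- exact: CI_class_absolutely_continuous.
- exact: absolutely_continuous_hard.
Qed.
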